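(* Let $G$ be a Carnot group of step $3$ endowed with a sub-Riemannian distance $d_G$. Then the sub-Riemannian distance $d$ on $G\times\mathbb R$ given by $$d((p,s),(q,t))=\sqrt{d_G(p,q)^2+|t-s|^2}$$ has a unit sphere $\{(q,t): d((0_G,0),(q,t))=1\}$ with a cusp at $(0_G,1)$.
   Context: A stratified group of step $s$ is a simply connected Lie group $G$ whose Lie algebra is decomposed as $\mathfrak g=\bigoplus_{i=1}^sV_i$ with $[V_1,V_i]=V_{i+1}$ for $i<s$, $V_s\neq\{0\}$ and $[V_1,V_s]=\{0\}$; $0_G$ is its neutral element. A sub-Riemannian distance on $G$ is obtained from a scalar product on $V_1$ with norm $\|\cdot\|$: $d_G(p,q)$ is the infimum of $\int_0^1\|u(t)\|dt$ over $u\in L^\infty([0,1];V_1)$ such that the absolutely continuous curve with $\gamma(0)=p$, $\gamma'(t)=\mathrm dL_{\gamma(t)}(u(t))$ a.e. ($L_g$ is left translation) satisfies $\gamma(1)=q$. A stratified group with such a distance is a Carnot group. $G\times\mathbb R$ is a Carnot group with first layer $V_1\times\mathbb R$. Cusp: identify $G\times\mathbb R$ with its Lie algebra, a vector space, via the exponential map. A hypersurface $S$ has a cusp at $p\in S$ if there is a two-dimensional affine plane $\Pi\ni p$ with affine coordinates $(z,\tau)$ on $\Pi$ centered at $p$ such that, near $p$, $S\cap\Pi=\{(z,\tau):\tau\ge0,\ |z|=h(\tau)\}$ for a function $h$ with $h(0)=0$, $h(\tau)>0$ for $\tau>0$, and $h(\tau)/\tau\to0$ as $\tau\to0^+$. 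*)

(* Defs.v *)
From HB Require Import structures.
From mathcomp Require Import all_boot all_order all_algebra.
From mathcomp Require Import all_classical all_reals all_analysis.

Set Implicit Arguments.
Unset Strict Implicit.
Unset Printing Implicit Defensive.

Import Order.TTheory GRing.Theory Num.Theory.
Import numFieldNormedType.Exports.

Local Open Scope classical_set_scope.
Local Open Scope ring_scope.

(* A real Lie algebra of dimension n is ['rV[R]_n] (a linear basis has been
   chosen) with a bracket [br].  A simply connected nilpotent Lie group is
   identified with its Lie algebra through the exponential map, which is then a
   diffeomorphism; the neutral element is 0 and the group law is given by the
   Baker-Campbell-Hausdorff formula. *)

Section LieAlgebra.
Variables (R : realType) (n : nat).
Local Notation g := 'rV[R]_n.
Implicit Types (br : g -> g -> g) (x y z : g).

Record is_lie_bracket br : Prop := IsLieBracket {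
  lie_linearr : forall x, linear (br x) ;
  lie_linearl : forall y, linear (br^~ y) ;
  lie_alternating : forall x, br x x = 0 ;
  lie_jacobi : forall x y z,
    br x (br y z) + br y (br z x) + br z (br x y) = 0
}.

(* The linear span of all the brackets [br x y] with x in U and y in W: by
   bilinearity it is spanned by the brackets of basis vectors. *)
Definition lie_prod br (U W : {vspace g}) : {vspace g} :=
  <<[seq br x y | x <- vbasis U, y <- vbasis W]>>%VS.

(* The layers are indexed from 1; the values of [V] at 0 and above s are
   irrelevant. *)
Record is_stratification br (s : nat) (V : nat -> {vspace g}) : Prop :=
  IsStratification {
  strat_direct : directv (\sum_(i < s) V i.+1)%VS ;
  strat_full : (\sum_(i < s) V i.+1)%VS = fullv ;
  strat_generated : forall i, (0 < i < s)%N ->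
    lie_prod br (V 1%N) (V i) = V i.+1 ;
  strat_nonzero : V s != 0%VS ;
  strat_nilpotent : lie_prod br (V 1%N) (V s) = 0%VS
}.

(* The Baker-Campbell-Hausdorff formula up to brackets of length 3: this is the
   group law exactly when the brackets of length 4 vanish, i.e., in step at
   most 3. *)
Definition bch br x y : g :=
  x + y + 2^-1 *: br x y + 12^-1 *: (br x (br x y) + br y (br y x)).

(* The differential at the neutral element of the left translation by [x]. *)
Definition dleft br x (v : g) : g := 'd (bch br x) (0 : g) v.

End LieAlgebra.

Definition absolutely_continuous (R : realType) (W : normedModType R)
    (a b : R) (f : R -> W) : Prop :=
  forall e : R, 0 < e -> exists2 delta : R, 0 < delta &
    forall (m : nat) (I : 'I_m -> R * R),
      (forall i, [/\ a <= (I i).1, (I i).1 <= (I i).2 & (I i).2 <= b]) ->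
      trivIset setT (fun i => `](I i).1, (I i).2[%classic) ->
      \sum_(i < m) ((I i).2 - (I i).1) < delta ->
      \sum_(i < m) `|f (I i).2 - f (I i).1| < e.

Section SubRiemannian.
Variables (R : realType) (n : nat).
Local Notation g := 'rV[R]_n.
Variables (br : g -> g -> g) (V1 : {vspace g}).
Local Notation mu := (@lebesgue_measure R).
Local Notation I01 := (`[0%R, 1%R]%classic : set R).

Definition dot_norm (ip : {dot (subvs_of V1) for idfun}) (v : subvs_of V1) : R :=
  Num.sqrt (ip v v).

(* [u] is (a representative of) an element of L^oo([0, 1]; V1). *)
Definition is_control (ip : {dot (subvs_of V1) for idfun})
    (u : R -> subvs_of V1) : Prop :=
  (forall i, measurable_fun I01 (fun t => vsval (u t) 0 i)) /\
  (exists M : R, {ae mu, forall t, I01 t -> dot_norm ip (u t) <= M}).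

Definition horizontal_curve (u : R -> subvs_of V1) (gamma : R -> g) : Prop :=
  absolutely_continuous 0 1 gamma /\
  {ae mu, forall t, I01 t ->
    is_derive t (1 : R) gamma (dleft br (gamma t) (vsval (u t)))}.

(* The infimum is taken in the extended reals: it is +oo if no control steers p
   to q. *)
Definition sr_dist (ip : {dot (subvs_of V1) for idfun}) (p q : g) : \bar R :=
  ereal_inf [set (\int[mu]_(t in I01) (dot_norm ip (u t))%:E)%E | u in
    [set u | is_control ip u /\ exists gamma, [/\ horizontal_curve u gamma,
                                                gamma 0 = p & gamma 1 = q]]].

Definition is_sr_distance (d : g -> g -> \bar R) : Prop :=
  exists ip : {dot (subvs_of V1) for idfun}, forall p q, d p q = sr_dist ip p q.

End SubRiemannian.

Section TimesR.
Variables (R : realType) (n : nat).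

(* The point (p, t) of G x R. *)
Definition pairR (p : 'rV[R]_n) (t : R) : 'rV[R]_(n + 1) := row_mx p t%:M.

(* The bracket of the product Lie algebra, where R is abelian. *)
Definition bracketR (br : 'rV[R]_n -> 'rV[R]_n -> 'rV[R]_n)
    (x y : 'rV[R]_(n + 1)) : 'rV[R]_(n + 1) :=
  pairR (br (lsubmx x) (lsubmx y)) 0.

(* V1 x R, as the inverse image of V1 under the projection (p, t) |-> p. *)
Definition layerR (V1 : {vspace 'rV[R]_n}) : {vspace 'rV[R]_(n + 1)} :=
  (linfun (@lsubmx R 1 n 1) @^-1: V1)%VS.

End TimesR.

(* The affine plane through [p] directed by [a] and [b] carries the affine
   coordinates (z, tau) |-> p + z a + tau b. *)
Definition has_cusp (R : realType) (m : nat) (S : set 'rV[R]_m)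
    (p : 'rV[R]_m) : Prop :=
  S p /\
  exists a b : 'rV[R]_m, free [:: a; b] /\
  exists h : R -> R,
    [/\ h 0 = 0,
        forall tau, 0 < tau -> 0 < h tau,
        h tau / tau @[tau --> 0^'+] --> (0 : R) &
        exists2 U, nbhs p U &
          S `&` [set p + w.1 *: a + w.2 *: b | w in [set: R * R]] `&` U =
          [set p + w.1 *: a + w.2 *: b | w in
             [set w : R * R | 0 <= w.2 /\ `|w.1| = h w.2]] `&` U].

(* Main.v *)
(* The distance on the product.  A curve in G x R is a pair of a horizontal
   curve in G with control u and a scalar curve with derivative v, and its
   length is the integral of sqrt(|u|^2 + v^2).  Cauchy-Schwarz under the
   integral gives the lower bound; for the upper bound one lets v be
   proportional to |u|.

   The cusp.  For z in the third layer the dilations give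
   d_G(0, l^3 z) = |l| d_G(0, z).  Hence, if 0 < c = d_G(0, z) < +oo, the unit
   sphere meets the plane through (0, 1) spanned by (z, 0) and (0, -1) along
   c^2 |w|^(2/3) + (1 - tau)^2 = 1, that is
   |w| = ((2 tau - tau^2) / c^2)^(3/2), which is o(tau).
   For c < +oo an explicit polynomial horizontal curve joins 0 to a multiple of
   [x, [x, y]], a double bracket which does not vanish for some x, y in the
   first layer; for c > 0, the speed of a horizontal curve is at most M |u| as
   long as the curve stays in a bounded region.

   The link between a curve and its control is the mean value inequality
   |f(b) - f(a)| <= int_a^b w for an absolutely continuous f with |f'| <= w
   almost everywhere. *)
Require Import Defs.
From HB Require Import structures.
From mathcomp Require Import all_boot all_order all_algebra.
From mathcomp Require Import all_classical all_reals all_analysis.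
From mathcomp Require Import measurable_realfun.
From mathcomp Require Import lra ring.
Set Implicit Arguments.
Unset Strict Implicit.
Unset Printing Implicit Defensive.
Import Order.TTheory GRing.Theory Num.Theory.
Import numFieldNormedType.Exports.
Local Open Scope classical_set_scope.
Local Open Scope ring_scope.

(** * A mean value inequality for absolutely continuous curves *)

(** The definition of the derivative unpacked into an explicit radius; these radii supply the gauge
    in [ac_norm_le_integral]. *)
Lemma derive_approx (R : realType) (W : normedModType R) (f : R -> W) (t : R) l (e : R) :
    is_derive t (1 : R) f l -> 0 < e ->
  exists2 r, 0 < r & forall s, `|s - t| < r ->
    `|f s - f t - (s - t) *: l| <= e * `|s - t|.
Proof.
case=> df dl e0; have /eqaddoP /(_ e e0) := derivable_nbhs df.
rewrite dl => /nbhs_ballP[r /= r0 rP]; exists r => // s st.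
have /rP /= : ball 0 r (s - t) by rewrite /ball/= sub0r normrN.
rewrite !fctE /= (_ : _ *: _ = s - t) ?[LHS]mulr1// addrNK opprD addrA.
exact.
Qed.

Section MeanValue.
Variables (R : realType) (W : normedModType R).
Local Notation mu := (@lebesgue_measure R).
Implicit Types (f : R -> W) (a b c d t : R).

(* Cousin's argument: by compactness [a, b] is cut into small tagged intervals;
   the [I i] are those along which the increment of [f] is not controlled by
   [Phi]. *)
Lemma gauge_chain f (Phi : R -> R) (U : set R) a b : a <= b ->
  {in `[a, b] &, {homo Phi : x y / x <= y}} ->
  (forall t, t \in `[a, b] -> exists2 r, 0 < r &
     (forall c d, a <= c <= t -> t <= d <= b -> t - c < r -> d - t < r ->
        `|f d - f c| <= Phi d - Phi c) \/
     (forall c d, a <= c <= t -> t <= d <= b -> t - c < r -> d - t < r ->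
        `[c, d[ `<=` U)) ->
  exists m (I : nat -> R * R),
    [/\ forall i, (i < m)%N ->
          [/\ a <= (I i).1, (I i).1 <= (I i).2, (I i).2 <= b &
              `[(I i).1, (I i).2[ `<=` U],
        forall i j, (i < j < m)%N -> (I i).2 <= (I j).1 &
        `|f b - f a| <= Phi b - Phi a +
                        \sum_(i < m) `|f (I i).2 - f (I i).1|].
Proof.
move=> ab Phim gauge.
(* Continuous induction: [P t] is the conclusion on [a, t], and the supremum [s] of the good [t]
   will turn out to be [b]. *)
pose P t := exists m (I : nat -> R * R),
    [/\ forall i, (i < m)%N ->
          [/\ a <= (I i).1, (I i).1 <= (I i).2, (I i).2 <= t &
              `[(I i).1, (I i).2[ `<=` U],
        forall i j, (i < j < m)%N -> (I i).2 <= (I j).1 &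
        `|f t - f a| <= Phi t - Phi a +
                        \sum_(i < m) `|f (I i).2 - f (I i).1|].
pose S := [set t | a <= t <= b /\ P t].
have Sa : S a.
  split; first by rewrite lexx.
  exists 0%N, (fun=> (a, a)); split=> //.
  by rewrite big_ord0 !subrr normr0 addr0.
have supS : has_sup S.
  by split; [exists a | exists b => t [/andP[]]].
set s := sup S.
have as_ : a <= s by apply: ub_le_sup => //; case: supS.
have sb : s <= b by apply: ge_sup; [exists a | move=> t [/andP[]]].
have [|r r0 gr] := gauge s; first by rewrite in_itv/= as_ sb.
have [t0 [/andP[at0 t0b] Pt0] st0] := sup_adherent r0 supS.
have t0s : t0 <= s.
  by apply: ub_le_sup => //; [case: supS|split => //; rewrite at0].
(* A chain ending at some [t0] within [r] of [s] extends across [s] in one piece: either [Phi]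
   controls the increment on [t0, d], or the piece lies in [U] and is appended to the family. *)
have step d : s <= d -> d <= b -> d - s < r -> P d.
  move=> sd db dsr; have [m [I [I1 I2 I3]]] := Pt0.
  have t0d : t0 <= d := le_trans t0s sd.
  have tri : `|f d - f a| <= `|f t0 - f a| + `|f d - f t0|.
    by rewrite [leRHS]addrC ler_distD.
  have t0r : s - t0 < r by rewrite ltrBlDl -ltrBlDr.
  case: gr => gr.
    exists m, I; split=> //.
      by move=> i /I1[? ? ? ?]; split=> //; apply: le_trans t0d.
    apply: (le_trans tri).
    have := gr t0 d; rewrite at0 t0s sd db => /(_ isT isT t0r dsr).
    by move: I3; set sg := \sum_(i < m) _; lra.
  exists m.+1, (fun i => if (i < m)%N then I i else (t0, d)); split.
  - move=> i; rewrite ltnS leq_eqVlt => /orP[/eqP->|im].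
      rewrite ltnn/=; split=> //; apply: gr => //.
        by rewrite at0.
      by rewrite sd.
    by rewrite im; have [? ? ? ?] := I1 _ im; split=> //; apply: le_trans t0d.
  - move=> i j /andP[ij]; rewrite ltnS leq_eqVlt => /orP[/eqP jm|jm].
      by subst j; rewrite ltnn ij/=; case: (I1 _ ij).
    by rewrite jm (ltn_trans ij jm); apply: I2; rewrite ij.
  - rewrite big_ord_recr/= ltnn/=.
    under eq_bigr => i _ do rewrite ltn_ord.
    apply: (le_trans tri); move: I3; set sg := \sum_(i < m) _.
    have : Phi t0 <= Phi d.
      by apply: Phim => //; rewrite in_itv/= ?at0 ?(le_trans as_ sd).
    by lra.
suff sEb : s = b.
  have bsr : b - s < r by rewrite sEb subrr.
  exact: (step b sb (lexx b) bsr).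
(* If [s < b], the extension reaches a good point beyond the supremum. *)
apply/eqP; rewrite eq_le sb leNgt; apply/negP => sltb.
pose d := Num.min (s + r / 2) b.
have sd : s < d by rewrite lt_min sltb andbT; lra.
have db : d <= b by rewrite ge_min lexx orbT.
have : d <= s.
  apply: ub_le_sup; first by case: supS.
  split; first by rewrite db (le_trans as_ (ltW sd)).
  apply: step => //; first exact: ltW.
  have : d <= s + r / 2 by rewrite ge_min lexx.
  by move: r0; lra.
by rewrite leNgt sd.
Qed.

(* [gauge_chain] is applied to the primitive of [w] (plus a small slope) and to a
   small open neighbourhood [U] of the null set where the derivative is not
   controlled: absolute continuity makes the increments along [U] negligible. *)
Lemma ac_norm_le_integral f (w : R -> R) a b : a <= b ->
  absolutely_continuous a b f -> (forall t, 0 <= w t) ->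
  mu.-integrable `[a, b] (EFin \o w) ->
  {ae mu, forall t, `[a, b]%classic t ->
     exists2 l, is_derive t 1 f l & `|l| <= w t} ->
  `|f b - f a| <= \int[mu]_(t in `[a, b]) w t.
Proof.
move=> ab acf w0 iw df.
(* Extending [w] by 0 gives a primitive [F] on the whole line, with derivative [w'] almost
   everywhere. *)
pose w' := w \_ `[a, b].
have iw' : mu.-integrable setT (EFin \o w').
  by rewrite /w' -restrict_EFin -integrable_mkcond//.
have iw'y y : mu.-integrable `]-oo, y] (EFin \o w').
  by apply: (integrableS _ _ _ iw').
have w'0 t : 0 <= w' t by rewrite /w' patchE; case: ifP.
pose F y := \int[mu]_(t in `]-oo, y]) w' t.
have loc : locally_integrable [set: R] w'.
  by apply: (integrable_locally _ iw).
have F1 : {ae mu, forall x, is_derive x (1 : R) F (w' x)}.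
  have := FTC1Ny iw'y loc.
  apply: filterS; first exact: (ae_filter_ringOfSetsType mu).
  by move=> x [dF F']; apply: DeriveDef; [exact: dF|rewrite -derive1E; exact: F'].
have Fb : F b - F a = \int[mu]_(t in `[a, b]) w t.
  rewrite /F Rintegral_itvB ?bnd_simp// Rintegral_itv_obnd_cbnd; last first.
    by apply: (integrableS _ _ _ iw').
  by apply: eq_Rintegral => t tab; rewrite /w' patchE tab.
rewrite -Fb; apply/ler_addgt0Pr => e e0.
have [A [mA A0 subA]] : mu.-negligible (~` [set t | `[a, b]%classic t ->
    (exists2 l, is_derive t 1 f l & `|l| <= w t) /\ is_derive t (1 : R) F (w' t)]).
  have : {ae mu, forall t, `[a, b]%classic t ->
    (exists2 l, is_derive t 1 f l & `|l| <= w t) /\ is_derive t (1 : R) F (w' t)}.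
    move: df F1; apply: filterS2; first exact: (ae_filter_ringOfSetsType mu).
    by move=> t h1 h2 tab; split; [exact: h1|].
  by [].
(* A slope [e'] contributes at most [e / 2] over [a, b]; the summand 1 keeps the denominator
   positive when [a = b]. *)
pose e' := e / (2 * (1 + (b - a))).
have e'0 : 0 < e' by rewrite divr_gt0// mulr_gt0//; lra.
have [dl dl0 dlP] := acf _ (divr_gt0 e0 (ltr0n R 2)).
have [U [oU AU UA]] : exists U : set R, [/\ open U, A `<=` U & (mu (U `\` A) < dl%:E)%E].
  have Aoo : (mu A < +oo)%E by rewrite A0.
  exact: lebesgue_regularity_outer.
have mU : measurable U by exact: measurable_realfun.open_measurable.
have Udl : (mu U < dl%:E)%E.
  suff : (mu U <= mu (U `\` A) + mu A)%E by rewrite A0 adde0 => /le_lt_trans; exact.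
  apply: le_trans (measureU2 _ _ _) => //; last exact: measurableD.
  by rewrite le_measure ?inE//; [apply: measurableU => //; exact: measurableD|
    move=> x Ux; have [Ax|Ax] := pselect (A x); [right|left]].
pose Phi t := F t + e' * (t - a).
have Fmono x y : x <= y -> F x <= F y.
  move=> xy; rewrite -subr_ge0 /F Rintegral_itvB ?bnd_simp//.
  by apply: Rintegral_ge0.
have [||m [I [I1 I2 I3]]] := @gauge_chain f Phi U a b ab.
- move=> x y; rewrite !in_itv/= => /andP[ax xb] /andP[ay yb] xy.
  by rewrite lerD ?Fmono// ler_wpM2l ?lerB// ltW.
- move=> t tab; have [At|At] := pselect (A t).
    have /nbhs_ballP[r /= r0 rU] : nbhs t U by apply: open_nbhs_nbhs; split => //; exact: AU.
    exists r => //; right => c d /andP[ac ct] /andP[td db] tc dt x /=.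
    rewrite in_itv/= => /andP[cx xd]; apply: rU; rewrite /ball/= ltr_distlC; lra.
  (* Outside [A] both derivatives exist at [t]. Each linear approximation costs [e' / 2] per unit
     length, and the slope [e'] in [Phi] absorbs the two errors. *)
  have [//|[l fl lw] iF] : [set t | `[a, b]%classic t ->
      (exists2 l, is_derive t 1 f l & `|l| <= w t) /\ is_derive t (1 : R) F (w' t)] t.
    by apply: contrapT => /subA.
  have wt : w' t = w t by rewrite /w' patchE mem_set.
  have e'2 : 0 < e' / 2 by rewrite divr_gt0.
  have [r1 r10 r1P] := derive_approx fl e'2.
  have [r2 r20 r2P] := derive_approx iF e'2.
  exists (Num.min r1 r2); first by rewrite lt_min r10.
  left => c d /andP[ac ct] /andP[td db]; rewrite !lt_min.
  move=> /andP[tc1 tc2] /andP[dt1 dt2].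
  have ntc : `|c - t| = t - c by rewrite distrC ger0_norm// subr_ge0.
  have ndt : `|d - t| = d - t by rewrite ger0_norm// subr_ge0.
  have := r1P c; rewrite ntc => /(_ tc1) c1.
  have := r1P d; rewrite ndt => /(_ dt1) d1.
  have := r2P c; rewrite ntc => /(_ tc2); rewrite ler_norml => /andP[c2 c2'].
  have := r2P d; rewrite ndt => /(_ dt2); rewrite ler_norml => /andP[d2 d2'].
  have fd : `|f d - f t| <= e' / 2 * (d - t) + (d - t) * w t.
    rewrite -[f d - f t](subrK ((d - t) *: l)) (le_trans (ler_normD _ _))//.
    by rewrite lerD// normrZ ndt ler_wpM2l// subr_ge0.
  have fc : `|f c - f t| <= e' / 2 * (t - c) + (t - c) * w t.
    rewrite -[f c - f t](subrK ((c - t) *: l)) (le_trans (ler_normD _ _))//.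
    by rewrite lerD// normrZ ntc ler_wpM2l// subr_ge0.
  have : `|f d - f c| <= `|f d - f t| + `|f c - f t|.
    by rewrite (distrC (f c)) ler_distD.
  rewrite /Phi; move: c2' d2 fd fc; rewrite /GRing.scale/= wt; clear; lra.
(* The intervals are disjoint and contained in [U], so their total length is below the threshold
   [dl] of absolute continuity. Half-open intervals are used because consecutive ones may share an
   endpoint. *)
have : \sum_(i < m) `|f (I i).2 - f (I i).1| < e / 2.
  pose J (i : 'I_m) := `[(I i).1, (I i).2[%classic.
  have tJ : trivIset setT J.
    have JJ (i j : 'I_m) : (i < j)%N -> J i `&` J j = set0.
      move=> ij; rewrite -subset0 => x []; rewrite /J/= !in_itv/=.
      move=> /andP[_ xi] /andP[jx _].
      by have := I2 i j; rewrite ij ltn_ord => /(_ isT); lra.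
    apply/trivIsetP => i j _ _; rewrite -val_eqE neq_ltn => /orP[/JJ//|/JJ].
    by rewrite setIC.
  have tJ' : trivIset setT (fun i : 'I_m => `](I i).1, (I i).2[%classic).
    move=> i j _ _ [x [xi xj]]; apply: tJ => //; exists x.
    by split; exact: subset_itv_oo_co.
  apply: dlP => //; first by move=> i; case: (I1 i (ltn_ord i)).
  rewrite -lte_fin (le_lt_trans _ Udl)// -sumEFin.
  have -> : (\sum_(i < m) ((I i).2 - (I i).1)%:E = \sum_(i < m) mu (J i))%E.
    apply: eq_bigr => i _; rewrite /J lebesgue_measure_itv/= lte_fin.
    case: ltP => // h; case: (I1 i (ltn_ord i)) => _ h' _ _.
    by rewrite (@le_anti _ _ (I i).1 (I i).2) ?h'// subrr.
  have mJ i : measurable (J i) by exact: measurable_itv.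
  rewrite -(measure_bigsetU_ord mu xpredT mJ tJ).
  have mJU : measurable (\big[setU/set0]_(i < m) J i) by exact: bigsetU_measurable.
  apply: le_measure; rewrite ?inE//.
  elim/big_ind : _ => //; first by move=> A1 A2 A1U A2U x [/A1U|/A2U].
  by move=> i _; case: (I1 i (ltn_ord i)).
have : Phi b - Phi a <= F b - F a + e / 2.
  have : e' * (b - a) <= e / 2.
    rewrite /e' invfM mulrA -[leRHS]mulr1 -mulrA ler_wpM2l//.
      by rewrite divr_ge0// ltW.
    by rewrite mulrC ler_pdivrMr; lra.
  by rewrite /Phi; lra.
by move: I3; set sg := \sum_(i < m) _; lra.
Qed.

End MeanValue.

(** * Linear maps and absolutely continuous curves *)
Section RowVectors.
Variable R : realType.

Lemma ler_row_norm n (x : 'rV[R]_n) i : `|x 0 i| <= `|x|.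
Proof.
rewrite [leRHS]/Num.Def.normr/= mx_normrE.
exact: (@le_bigmax _ _ _ 0 (fun ij : 'I_1 * 'I_n => `|x ij.1 ij.2|) (0, i)).
Qed.

Lemma row_norm_le n (x : 'rV[R]_n) (M : R) : 0 <= M ->
  (forall i, `|x 0 i| <= M) -> `|x| <= M.
Proof.
move=> M0 xM; rewrite [leLHS]/Num.Def.normr/= mx_normrE.
by apply: bigmax_le => // -[i j] _ /=; rewrite (ord1 i).
Qed.

Lemma linear_row_bound n (W : normedModType R) (L : {linear 'rV[R]_n -> W}) :
  exists2 K, 0 <= K & forall x, `|L x| <= K * `|x|.
Proof.
exists (\sum_(i < n) `|L 'e_i|); first exact: sumr_ge0.
move=> x; rewrite [in leLHS](row_sum_delta x) linear_sum.
rewrite (le_trans (ler_norm_sum _ _ _))// mulr_suml ler_sum// => i _.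
by rewrite linearZ normrZ mulrC ler_wpM2l// ler_row_norm.
Qed.

Lemma linear_row_continuous n (W : normedModType R)
  (L : {linear 'rV[R]_n -> W}) : continuous L.
Proof.
have [K K0 KP] := linear_row_bound L.
apply: bounded_linear_continuous; exists K; split; first exact: ger0_real.
move=> M KM; apply/nbhs_ballP; exists 1 => //= x.
rewrite -ball_normE/= sub0r normrN => x1.
by rewrite (le_trans (KP x))// (le_trans _ (ltW KM))// ler_piMr// ltW.
Qed.

Lemma is_derive_linear n (W : normedModType R) (L : {linear 'rV[R]_n -> W})
    (g : R -> 'rV[R]_n) (t : R) l :
  is_derive t (1 : R) g l -> is_derive t (1 : R) (L \o g) (L l).
Proof.
case=> dg <-.
have h : (fun h : R => h^-1 *: ((L \o g) (h *: (1 : R) + t) - (L \o g) t))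
    @ 0^' --> L ('D_1 g t).
  rewrite (_ : (fun _ => _) =
      L \o (fun h : R => h^-1 *: (g (h *: (1 : R) + t) - g t))); last first.
    by apply/funext => x /=; rewrite linearZ_LR; congr (_ *: _); rewrite linearB.
  by apply: cvg_comp; [exact: dg|exact: linear_row_continuous].
by apply: DeriveDef; [apply/cvg_ex; exists (L ('D_1 g t))|exact: cvg_lim].
Qed.

Lemma ac_linear n (W : normedModType R) (L : {linear 'rV[R]_n -> W})
    (g : R -> 'rV[R]_n) (a b : R) :
  absolutely_continuous a b g -> absolutely_continuous a b (L \o g).
Proof.
move=> acg e e0; have [K K0 KP] := linear_row_bound L.
have K1 : 0 < K + 1 by lra.
have [r r0 rP] := acg (e / (K + 1)) (divr_gt0 e0 K1).
exists r => // m I I1 I2 I3; have := rP m I I1 I2 I3.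
rewrite ltr_pdivlMr// => /(le_lt_trans _); apply.
rewrite mulr_suml ler_sum// => i _ /=; rewrite -linearB (le_trans (KP _))//.
by rewrite mulrC ler_wpM2l//; lra.
Qed.

Lemma acD (W : normedModType R) (f g : R -> W) (a b : R) :
  absolutely_continuous a b f -> absolutely_continuous a b g ->
  absolutely_continuous a b (fun t => f t + g t).
Proof.
move=> acf acg e e0; have e2 : 0 < e / 2 by rewrite divr_gt0.
have [r r0 rP] := acf _ e2; have [s s0 sP] := acg _ e2.
exists (Num.min r s); first by rewrite lt_min r0.
move=> m I I1 I2; rewrite lt_min => /andP[Ir Is].
have := rP m I I1 I2 Ir; have := sP m I I1 I2 Is.
suff : \sum_(i < m) `|f (I i).2 + g (I i).2 - (f (I i).1 + g (I i).1)| <=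
  \sum_(i < m) `|f (I i).2 - f (I i).1| + \sum_(i < m) `|g (I i).2 - g (I i).1|.
  by move: (\sum_(i < m) _) (\sum_(i < m) _) (\sum_(i < m) _) => x y z; lra.
by rewrite -big_split ler_sum// => i _; rewrite opprD addrACA ler_normD.
Qed.

Lemma lipschitz_ac (W : normedModType R) (f : R -> W) (a b K : R) :
  (forall s t, a <= s -> s <= t -> t <= b -> `|f t - f s| <= K * (t - s)) ->
  absolutely_continuous a b f.
Proof.
move=> fK e e0; have K1 : 0 < `|K| + 1 by apply: ltr_pwDr.
exists (e / (`|K| + 1)); first exact: divr_gt0.
move=> m I I1 _; rewrite ltr_pdivlMr// => /(le_lt_trans _); apply.
rewrite mulr_suml ler_sum// => i _; have [I11 I12 I13] := I1 i.
rewrite (le_trans (fK _ _ I11 I12 I13))// mulrC ler_wpM2l ?subr_ge0//.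
by rewrite (le_trans (ler_norm _))// lerDl.
Qed.

Lemma ac_sub (W : normedModType R) (f : R -> W) (a b a' b' : R) :
  a <= a' -> b' <= b ->
  absolutely_continuous a b f -> absolutely_continuous a' b' f.
Proof.
move=> aa bb acf e e0; have [r r0 rP] := acf e e0; exists r => // m I I1.
apply: rP => i; have [h1 h2 h3] := I1 i.
by split=> //; [exact: le_trans h1|exact: le_trans bb].
Qed.

Lemma ac_dist (W : normedModType R) (f : R -> W) (a b : R) :
  absolutely_continuous a b f -> forall e, 0 < e -> exists2 r, 0 < r &
    forall s t, a <= s -> s <= t -> t <= b -> t - s < r -> `|f t - f s| < e.
Proof.
move=> acf e e0; have [r r0 rP] := acf e e0; exists r => // s t as_ st tb tsr.
have := rP 1%N (fun=> (s, t)); rewrite !big_ord1/=; apply=> //.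
by move=> i j _ _ _; rewrite !ord1.
Qed.

End RowVectors.

(** * Lie brackets and left translations *)
Section BracketAlgebra.
Variables (R : realType) (n : nat) (br : 'rV[R]_n -> 'rV[R]_n -> 'rV[R]_n).
Hypothesis brH : is_lie_bracket br.

(** The two partial maps of the bracket are packed as linear maps, so that the general lemmas on
    linear maps apply to them. *)
Definition brr x : {linear 'rV[R]_n -> 'rV[R]_n} :=
  HB.pack (br x) (GRing.isLinear.Build _ _ _ _ (br x) (lie_linearr brH x)).
Definition brl y : {linear 'rV[R]_n -> 'rV[R]_n} :=
  HB.pack (br^~ y) (GRing.isLinear.Build _ _ _ _ (br^~ y) (lie_linearl brH y)).

Lemma brDr x y z : br x (y + z) = br x y + br x z.
Proof. exact: (linearD (brr x)). Qed.
Lemma brDl x y z : br (x + y) z = br x z + br y z.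
Proof. exact: (linearD (brl z)). Qed.
Lemma brZr a x y : br x (a *: y) = a *: br x y.
Proof. exact: (linearZ_LR (brr x)). Qed.
Lemma brZl a x y : br (a *: x) y = a *: br x y.
Proof. exact: (linearZ_LR (brl y)). Qed.
Lemma br0r x : br x 0 = 0. Proof. exact: (linear0 (brr x)). Qed.
Lemma br0l x : br 0 x = 0. Proof. exact: (linear0 (brl x)). Qed.
Lemma brNr x y : br x (- y) = - br x y. Proof. exact: (linearN (brr x)). Qed.
Lemma br_sumr x I r (P : pred I) F :
  br x (\sum_(i <- r | P i) F i) = \sum_(i <- r | P i) br x (F i).
Proof. exact: (linear_sum (brr x)). Qed.
Lemma br_suml x I r (P : pred I) F :
  br (\sum_(i <- r | P i) F i) x = \sum_(i <- r | P i) br (F i) x.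
Proof. exact: (linear_sum (brl x)). Qed.

Lemma br_anti x y : br y x = - br x y.
Proof.
apply/eqP; rewrite -addr_eq0 addrC; apply/eqP.
have := lie_alternating brH (x + y).
by rewrite brDl !brDr !(lie_alternating brH) add0r addr0.
Qed.

Lemma br_bound : exists2 C, 0 <= C & forall x y, `|br x y| <= C * `|x| * `|y|.
Proof.
exists (\sum_(i < n) \sum_(j < n) `|br 'e_i 'e_j|).
  by apply: sumr_ge0 => i _; apply: sumr_ge0.
move=> x y; rewrite [in leLHS](row_sum_delta x) br_suml.
rewrite (le_trans (ler_norm_sum _ _ _))// !mulr_suml ler_sum// => i _.
rewrite brZl [in leLHS](row_sum_delta y) br_sumr normrZ.
rewrite (le_trans (ler_wpM2l _ (ler_norm_sum _ _ _)))// mulr_sumr !mulr_suml.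
rewrite ler_sum// => j _; rewrite brZr normrZ.
rewrite mulrA -[leRHS]mulrA [leRHS]mulrC ler_wpM2r//.
by rewrite ler_pM// ler_row_norm.
Qed.

(** The part of [bch br x v] of degree 1 in [v]. *)
Definition dbch x v := v + 2^-1 *: br x v + 12^-1 *: br x (br x v).

Lemma dbch_linear x : linear (dbch x).
Proof.
move=> a u v; rewrite /dbch !brDr !brZr.
by apply/rowP => i; rewrite !mxE; ring.
Qed.

(** The only term of [bch br x y] that is not affine in [y] is [br y (br y x)] up to a factor; it is
    quadratic in [y], hence negligible at 0. *)
Lemma dleftE x v : dleft br x v = dbch x v.
Proof.
rewrite /dleft.
pose D : {linear 'rV[R]_n -> 'rV[R]_n} :=
  HB.pack (dbch x) (GRing.isLinear.Build _ _ _ _ (dbch x) (@dbch_linear x)).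
suff -> : 'd (bch br x) (0 : 'rV[R]_n) = D :> ('rV[R]_n -> 'rV[R]_n) by [].
apply: diff_unique; first exact: linear_row_continuous.
apply/eqaddoP => e e0.
have [C C0 CP] := br_bound.
have K0 : 0 < C * (C * `|x|) + 1 by rewrite ltr_pwDr// !mulr_ge0.
near=> y.
have -> : (bch br x \o shift 0 - (cst (bch br x 0) + D)) y =
    12^-1 *: br y (br y x).
  rewrite !fctE/= /dbch /bch/= !addr0 !br0r !br0l.
  by apply/rowP => i; rewrite !mxE; ring.
rewrite normrZ ger0_norm; last by rewrite invr_ge0.
rewrite (@le_trans _ _ `|br y (br y x)|)// ?ler_piMl// ?invf_le1 ?ler1n//.
rewrite (le_trans (CP _ _))// mulrAC ler_wpM2r//.
rewrite (@le_trans _ _ (C * (C * `|y| * `|x|)))//; first by rewrite ler_wpM2l.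
rewrite (_ : _ * _ = (C * (C * `|x|)) * `|y|); last by ring.
have : `|y| <= e / (C * (C * `|x|) + 1).
  near: y; apply/nbhs_ballP; exists (e / (C * (C * `|x|) + 1)) => /=.
    exact: divr_gt0.
  by move=> z; rewrite -ball_normE/= sub0r normrN => /ltW.
rewrite ler_pdivlMr// mulrC => /(le_trans _); apply.
by rewrite ler_wpM2r// lerDl.
Unshelve. all: by end_near. Qed.

End BracketAlgebra.

(** * Scalar products and controls *)
Section DotProduct.
Variables (R : realType) (U : vectType R) (ip : {dot U for idfun}).
Implicit Types u v w : U.

Lemma dot_sym u v : ip u v = ip v u.
Proof. by rewrite hermC/= expr0 mul1r. Qed.

Lemma dotDl u v w : ip (u + v) w = ip u w + ip v w.
Proof. exact: linearDl. Qed.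
Lemma dotDr u v w : ip u (v + w) = ip u v + ip u w.
Proof. by rewrite dot_sym dotDl !(dot_sym u). Qed.
Lemma dotZl a u v : ip (a *: u) v = a * ip u v.
Proof. exact: linearZl_LR. Qed.
Lemma dotZr a u v : ip u (a *: v) = a * ip u v.
Proof. by rewrite dot_sym dotZl dot_sym. Qed.
Lemma dot0l u : ip 0 u = 0.
Proof. by rewrite -(scale0r 0) dotZl mul0r. Qed.
Lemma dot_suml u I r (P : pred I) F :
  ip (\sum_(i <- r | P i) F i) u = \sum_(i <- r | P i) ip (F i) u.
Proof.
by elim/big_rec2 : _ => [|i x y _ <-]; [exact: dot0l|exact: dotDl].
Qed.
Lemma dot_sumr u I r (P : pred I) F :
  ip u (\sum_(i <- r | P i) F i) = \sum_(i <- r | P i) ip u (F i).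
Proof. by rewrite dot_sym dot_suml; apply: eq_bigr => i _; rewrite dot_sym. Qed.

Lemma dot_ge0 u : 0 <= ip u u.
Proof.
have [->|u0] := eqVneq u 0; first by rewrite dot0l.
exact/ltW/neq0_dnorm_gt0.
Qed.

Lemma dot_cauchy_schwarz u v : ip u v ^+ 2 <= ip u u * ip v v.
Proof.
have [->|v0] := eqVneq v 0; first by rewrite dot_sym !dot0l mulr0 expr0n.
(* The squared norm of this vector is [ip v v] times the difference of the two sides. *)
have := dot_ge0 (ip v v *: u - ip u v *: v).
rewrite -scaleNr !dotDl !dotDr !dotZl !dotZr (dot_sym v u).
have : 0 < ip v v := neq0_dnorm_gt0 v v0; set x := ip v v; set y := ip u v; set z := ip u u.
move=> x0 h; have : 0 <= x * (z * x - y ^+ 2).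
  by rewrite (le_trans h)// le_eqVlt; apply/orP; left; apply/eqP; ring.
by rewrite (pmulr_rge0 _ x0) => h'; rewrite -subr_ge0.
Qed.

(** The map [T] sending [u] to the values [ip u b_j] on a basis is injective by positive
    definiteness, hence onto by equality of dimensions. *)
Lemma dot_riesz (phi : U -> R) : scalar phi ->
  exists w, forall v, phi v = ip w v.
Proof.
move=> phiL.
pose k := \dim {:U}; pose b : k.-tuple U := vbasis {:U}.
pose T u : 'rV[R]_k := \row_j ip u b`_j.
have TL : linear T by move=> a u v; apply/rowP => j; rewrite !mxE dotDl dotZl.
pose TT : {linear U -> 'rV[R]_k} :=
  HB.pack T (GRing.isLinear.Build _ _ _ _ T TL).
have phiE v : phi v = \sum_(i < k) coord b i v * phi b`_i.
  pose phi' : {scalar U} := HB.pack phi (GRing.isLinear.Build _ _ _ _ phi phiL).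
  rewrite -[phi v]/(phi' v) {1}(coord_vbasis (memvf v)) linear_sum.
  by apply: eq_bigr => i _; rewrite linearZ_LR.
have kerT : ({:U} :&: lker (linfun TT))%VS = 0%VS.
  apply/eqP; rewrite -subv0; apply/subvP => u.
  rewrite memv_cap memv_ker lfunE/= => /andP[_ /eqP Tu]; rewrite memv0.
  apply: contraT => u0; have : 0 < ip u u := neq0_dnorm_gt0 u u0.
  rewrite [X in ip _ X](coord_vbasis (memvf u)) dot_sumr big1 ?ltxx// => i _.
  rewrite dotZr; have := congr1 (fun x : 'rV[R]_k => x 0 i) Tu.
  by rewrite !mxE => ->; rewrite mulr0.
have imT : (linfun TT @: {:U})%VS = fullv.
  apply/eqP; rewrite eqEdim subvf/= (limg_dim_eq kerT).
  by rewrite dimvf/= /dim/= mul1n.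
have : (\row_j phi b`_j) \in (linfun TT @: {:U})%VS by rewrite imT memvf.
case/memv_imgP => w _; rewrite lfunE/= => /rowP wE; exists w => v.
rewrite phiE [in RHS](coord_vbasis (memvf v)) dot_sumr.
by apply: eq_bigr => i _; rewrite dotZr; have := wE i; rewrite !mxE => ->.
Qed.

End DotProduct.

Section DotNorm.
Variables (R : realType) (n : nat) (V1 : {vspace 'rV[R]_n}).
Variable ip : {dot (subvs_of V1) for idfun}.
Local Notation mu := (@lebesgue_measure R).
Local Notation I01 := (`[0%R, 1%R]%classic : set R).
Implicit Types (v : subvs_of V1) (u : R -> subvs_of V1).

Lemma dot_norm_ge0 v : 0 <= dot_norm ip v. Proof. exact: sqrtr_ge0. Qed.

Lemma sqr_dot_norm v : dot_norm ip v ^+ 2 = ip v v.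
Proof. by rewrite sqr_sqrtr// dot_ge0. Qed.

Lemma dot_normZ a v : dot_norm ip (a *: v) = `|a| * dot_norm ip v.
Proof. by rewrite /dot_norm dotZl dotZr mulrA sqrtrM ?sqr_ge0// sqrtr_sqr. Qed.

Lemma dot_normD v w : dot_norm ip (v + w) <= dot_norm ip v + dot_norm ip w.
Proof.
rewrite -(@ler_pXn2r _ 2%N)// ?nnegrE ?dot_norm_ge0 ?addr_ge0 ?dot_norm_ge0//.
rewrite sqrrD !sqr_dot_norm dotDl !dotDr (dot_sym _ w v).
have : ip v w <= dot_norm ip v * dot_norm ip w.
  rewrite (le_trans (ler_norm _))// -(@ler_pXn2r _ 2%N)// ?nnegrE//; last first.
    by rewrite mulr_ge0// dot_norm_ge0.
  by rewrite real_normK ?num_real// exprMn !sqr_dot_norm dot_cauchy_schwarz.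
by rewrite mulr2n; lra.
Qed.

(** Each coordinate is a linear form on [V1], so it is represented by a vector [w i] and bounded by
    Cauchy-Schwarz; this compares the ambient max norm with the norm of the scalar product. *)
Lemma vsval_bound : exists2 K, 0 <= K & forall v, `|vsval v| <= K * dot_norm ip v.
Proof.
have h i : exists w, forall v, vsval v 0 i = ip w v.
  by apply: dot_riesz => a u v; rewrite linearP !mxE.
have [w wP] := choice h.
exists (\sum_i dot_norm ip (w i)); first by apply: sumr_ge0 => i _; exact: dot_norm_ge0.
move=> v; apply: row_norm_le.
  by rewrite mulr_ge0 ?dot_norm_ge0// sumr_ge0// => i _; exact: dot_norm_ge0.
move=> i; rewrite wP (@le_trans _ _ (dot_norm ip (w i) * dot_norm ip v))//.
  rewrite -(@ler_pXn2r _ 2%N)// ?nnegrE//; last by rewrite mulr_ge0// dot_norm_ge0.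
  by rewrite real_normK ?num_real// exprMn !sqr_dot_norm dot_cauchy_schwarz.
rewrite ler_wpM2r ?dot_norm_ge0// (bigD1 i)//= lerDl sumr_ge0// => j _.
exact: dot_norm_ge0.
Qed.

(** [ip v v] is a quadratic polynomial in the coordinates of [vsval v], as one sees by expanding [v]
    in the projections to [V1] of the standard basis. *)
Lemma measurable_dot_norm (D : set R) u : measurable D ->
  (forall i, measurable_fun D (fun t => vsval (u t) 0 i)) ->
  measurable_fun D (fun t => dot_norm ip (u t)).
Proof.
move=> mD mu_.
have E v : ip v v = \sum_i \sum_j (vsval v 0 i * vsval v 0 j) *
    ip (vsproj V1 'e_i) (vsproj V1 'e_j).
  rewrite -[in LHS](vsvalK v) [in LHS](row_sum_delta (vsval v)) linear_sum.
  rewrite dot_suml; apply: eq_bigr => i _.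
  rewrite dot_sumr; apply: eq_bigr => j _.
  have PZ a x : vsproj V1 (a *: x) = a *: vsproj V1 x by exact: linearZ_LR.
  transitivity (ip (vsval v 0 i *: vsproj V1 'e_i) (vsval v 0 j *: vsproj V1 'e_j)).
    by congr (ip _ _); exact: PZ.
  by rewrite dotZl dotZr mulrA.
have h : measurable_fun D (fun t => ip (u t) (u t)).
  under eq_fun do rewrite E.
  apply: measurable_sum => i; apply: measurable_sum => j.
  by do 2 apply: measurable_funM => //.
exact: (measurableT_comp (continuous_measurable_fun (@sqrt_continuous R)) h).
Qed.

Lemma control_integrable u : is_control ip u ->
  mu.-integrable I01 (EFin \o (fun t => dot_norm ip (u t))).
Proof.
move=> [mu_ [M uM]]; have md := measurable_dot_norm (measurable_itv _) mu_.
apply/integrableP; split; first exact/measurable_EFinP.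
have uM' : {ae mu, forall t, I01 t ->
    (`|(EFin \o (fun t => dot_norm ip (u t))) t| <= cst `|M|%:E t)%E}.
  move: uM; apply: filterS; first exact: (ae_filter_ringOfSetsType mu).
  move=> t tM t01; rewrite /= lee_fin ger0_norm ?dot_norm_ge0//.
  by rewrite (le_trans (tM t01))// ler_norm.
apply: (@le_lt_trans _ _ (\int[mu]_(t in I01) (cst `|M|%:E t))%E).
  apply: ae_ge0_le_integral uM' => //; last by move=> t _ /=; rewrite lee_fin.
  exact: (measurableT_comp (@abse_measurable R setT) ((measurable_EFinP _ _).2 md)).
have m01 : (mu I01 < +oo)%E by rewrite lebesgue_measure_itv/= lte_fin ltr01 ltry.
have mI : measurable (I01 : set (measurableTypeR R)) by exact: measurable_itv.
have Ei := @integral_cst _ _ _ mu I01 mI `|M|%:E.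
rewrite Ei lte_mul_pinfty ?lee_fin//.
Qed.

(** Real-valued form of the integral in [sr_dist]; the two agree on controls, which are
    integrable. *)
Definition control_length u : R := \int[mu]_(t in I01) dot_norm ip (u t).

Lemma control_lengthE u : is_control ip u ->
  (\int[mu]_(t in I01) (dot_norm ip (u t))%:E)%E = (control_length u)%:E.
Proof.
move=> cu; rewrite /control_length /Rintegral fineK//.
by apply: integrable_fin_num => //; exact: control_integrable.
Qed.

Lemma control_length_ge0 u : 0 <= control_length u.
Proof. by apply: Rintegral_ge0 => t _; exact: dot_norm_ge0. Qed.

End DotNorm.

(** * Bounding the infimum that defines the distance *)

Section SubRiemannianDistance.
Variables (R : realType) (n : nat) (br : 'rV[R]_n -> 'rV[R]_n -> 'rV[R]_n).
Variables (V1 : {vspace 'rV[R]_n}) (ip : {dot (subvs_of V1) for idfun}).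
Local Notation mu := (@lebesgue_measure R).
Local Notation I01 := (`[0%R, 1%R]%classic : set R).
Implicit Types (p q : 'rV[R]_n) (u : R -> subvs_of V1).

Lemma sr_dist_le p q u g : is_control ip u -> horizontal_curve br u g ->
  g 0 = p -> g 1 = q -> (sr_dist br ip p q <= (control_length ip u)%:E)%E.
Proof.
move=> cu hg g0 g1; rewrite -control_lengthE//.
by apply: ereal_inf_lbound; exists u => //; split => //; exists g.
Qed.

Lemma sr_dist_ge (c : \bar R) p q :
  (forall u g, is_control ip u -> horizontal_curve br u g ->
    g 0 = p -> g 1 = q -> (c <= (control_length ip u)%:E)%E) ->
  (c <= sr_dist br ip p q)%E.
Proof.
move=> h; apply: le_ereal_inf_tmp => _ [u [cu [g [hg g0 g1]]] <-].
by rewrite control_lengthE//; exact: h hg g0 g1.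
Qed.

Lemma sr_dist_ge0 p q : (0 <= sr_dist br ip p q)%E.
Proof. by apply: sr_dist_ge => *; rewrite lee_fin control_length_ge0. Qed.

Lemma sr_dist_lt (c : R) p q : (sr_dist br ip p q < c%:E)%E ->
  exists u g, [/\ is_control ip u, horizontal_curve br u g,
    g 0 = p /\ g 1 = q & control_length ip u < c].
Proof.
move=> /ereal_inf_lt[_ [u [cu [g [hg g0 g1]]] <-]].
by rewrite control_lengthE// lte_fin => uc; exists u, g; split.
Qed.

(** The control is set to 0 where it exceeds its essential bound, which within [0, 1] happens on a
    null set only. A bound valid everywhere is what [bounded_primitive] asks for. *)
Lemma bounded_control u g : is_control ip u -> horizontal_curve br u g ->
  exists u' (M : R), [/\ is_control ip u', horizontal_curve br u' g,
    forall t, dot_norm ip (u' t) <= M &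
    control_length ip u' <= control_length ip u].
Proof.
move=> cu [acg dg]; have [mu_ [M uM]] := cu.
pose u' t := if dot_norm ip (u t) <= M then u t else 0.
have md := measurable_dot_norm ip (measurable_itv _) mu_.
have norm0 : dot_norm ip (0 : subvs_of V1) = 0.
  by rewrite /dot_norm dot0l sqrtr0.
have u'u t : dot_norm ip (u' t) <= dot_norm ip (u t).
  by rewrite /u'; case: ifP => // _; rewrite norm0 dot_norm_ge0.
have cu' : is_control ip u'.
  split; last first.
    exists M; move: uM; apply: filterS; first exact: (ae_filter_ringOfSetsType mu).
    by move=> t tM t01; rewrite (le_trans (u'u t))// tM.
  move=> i; rewrite (_ : (fun _ => _) =
    fun t => if dot_norm ip (u t) <= M then vsval (u t) 0 i else 0); last first.
    by apply/funext => t; rewrite /u'; case: ifP => // _; rewrite linear0 mxE.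
  apply: measurable_fun_if => //.
    by apply: measurable_fun_ler => //; exact: measurable_cst.
  by apply: measurable_funS (mu_ i) => //; exact: measurable_itv.
exists u', `|M|; split => //.
- split=> //; move: uM dg; apply: filterS2; first exact: (ae_filter_ringOfSetsType mu).
  by move=> t tM dg t01; rewrite /u' tM//; exact: dg.
- by move=> t; rewrite /u'; case: ifP => [h|_]; rewrite ?norm0// (le_trans h)// ler_norm.
- by apply: le_Rintegral => //; exact: control_integrable.
Qed.

End SubRiemannianDistance.

(** * The product with the real line *)
Section Pairs.
Variables (R : realType) (n : nat) (br : 'rV[R]_n -> 'rV[R]_n -> 'rV[R]_n).
Hypothesis brH : is_lie_bracket br.
Implicit Types (x y : 'rV[R]_(n + 1)) (p : 'rV[R]_n) (t : R).

Lemma lsubmx_pairR p t : lsubmx (pairR p t) = p. Proof. exact: row_mxKl. Qed.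
Lemma rsubmx_pairR p t : rsubmx (pairR p t) = t%:M. Proof. exact: row_mxKr. Qed.

Lemma pairRK x : pairR (lsubmx x) (rsubmx x 0 0) = x.
Proof. by rewrite /pairR -mx11_scalar hsubmxK. Qed.

Lemma pairR_inj_ext x y : lsubmx x = lsubmx y -> rsubmx x = rsubmx y -> x = y.
Proof. by move=> l r; rewrite -(hsubmxK x) l r hsubmxK. Qed.

Lemma bracketR_lie : is_lie_bracket (bracketR br).
Proof.
split.
- move=> x a y z; apply: pairR_inj_ext.
    rewrite linearP/= /bracketR !lsubmx_pairR linearP/=.
    by rewrite (brDr brH) (brZr brH).
  by rewrite linearP/= /bracketR !rsubmx_pairR raddf0 scaler0 addr0.
- move=> x a y z; apply: pairR_inj_ext.
    rewrite linearP/= /bracketR !lsubmx_pairR linearP/=.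
    by rewrite (brDl brH) (brZl brH).
  by rewrite linearP/= /bracketR !rsubmx_pairR raddf0 scaler0 addr0.
- move=> x; apply: pairR_inj_ext.
    by rewrite /bracketR lsubmx_pairR (lie_alternating brH) linear0.
  by rewrite /bracketR rsubmx_pairR linear0 raddf0.
- move=> x y z; apply: pairR_inj_ext.
    by rewrite !linearD/= /bracketR !lsubmx_pairR (lie_jacobi brH) linear0.
  by rewrite !linearD/= /bracketR !rsubmx_pairR raddf0 !addr0 linear0.
Qed.

Lemma lsubmx_dleft x y :
  lsubmx (dleft (bracketR br) x y) = dleft br (lsubmx x) (lsubmx y).
Proof.
rewrite (dleftE brH) (dleftE bracketR_lie) /dbch !linearD/= !linearZ/=.
by rewrite /bracketR !lsubmx_pairR.
Qed.

Lemma rsubmx_dleft x y : rsubmx (dleft (bracketR br) x y) = rsubmx y.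
Proof.
rewrite (dleftE bracketR_lie) /dbch !linearD/= !linearZ/=.
by rewrite /bracketR !rsubmx_pairR raddf0 !scaler0 !addr0.
Qed.

Lemma pairRE p t : pairR p t = pairR p 0 + t *: pairR 0 1.
Proof.
apply: pairR_inj_ext; rewrite linearD/= linearZ/=.
  by rewrite !lsubmx_pairR scaler0 addr0.
by rewrite !rsubmx_pairR raddf0 add0r scale_scalar_mx mulr1.
Qed.

Lemma pairR0_linear : linear (fun p => pairR p 0).
Proof.
move=> a p q; apply: pairR_inj_ext; rewrite linearP/=.
  by rewrite !lsubmx_pairR.
by rewrite !rsubmx_pairR raddf0 scaler0 addr0.
Qed.

Definition pairR0 : {linear 'rV[R]_n -> 'rV[R]_(n + 1)} :=
  HB.pack (fun p => pairR p 0)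
    (GRing.isLinear.Build _ _ _ _ (fun p => pairR p 0) pairR0_linear).

Variable V1 : {vspace 'rV[R]_n}.

Lemma mem_layerR x : (x \in layerR V1) = (lsubmx x \in V1).
Proof. by rewrite /layerR -memv_preim lfunE. Qed.

Variable ip : {dot (subvs_of V1) for idfun}.

Definition hpart (w : subvs_of (layerR V1)) : subvs_of V1 :=
  vsproj V1 (lsubmx (vsval w)).
Definition vpart (w : subvs_of (layerR V1)) : R := rsubmx (vsval w) 0 0.
Definition mkpair (v : subvs_of V1) (t : R) : subvs_of (layerR V1) :=
  vsproj (layerR V1) (pairR (vsval v) t).

Lemma vsval_hpart w : vsval (hpart w) = lsubmx (vsval w).
Proof. by rewrite vsprojK// -mem_layerR subvsP. Qed.
Lemma vsval_mkpair v t : vsval (mkpair v t) = pairR (vsval v) t.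
Proof. by rewrite vsprojK// mem_layerR lsubmx_pairR subvsP. Qed.
Lemma hpart_mkpair v t : hpart (mkpair v t) = v.
Proof. by apply: val_inj; rewrite /= vsval_hpart vsval_mkpair lsubmx_pairR. Qed.
Lemma vpart_mkpair v t : vpart (mkpair v t) = t.
Proof. by rewrite /vpart vsval_mkpair rsubmx_pairR mxE eqxx mulr1n. Qed.

Lemma hpartP a w w' : hpart (a *: w + w') = a *: hpart w + hpart w'.
Proof.
apply: val_inj; rewrite -[LHS]/(vsval _) -[RHS]/(vsval _).
by rewrite vsval_hpart !linearP/= !vsval_hpart.
Qed.
Lemma vpartP a w w' : vpart (a *: w + w') = a * vpart w + vpart w'.
Proof. by rewrite /vpart !linearP/= !mxE. Qed.

(** The orthogonal sum of [ip] and the standard scalar product of the real line. *)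
Definition dotR_fun (w w' : subvs_of (layerR V1)) : R :=
  ip (hpart w) (hpart w') + vpart w * vpart w'.

Lemma dotR_exists : exists ip' : {dot (subvs_of (layerR V1)) for idfun},
  forall w w', ip' w w' = dotR_fun w w'.
Proof.
have symf w w' : dotR_fun w w' = dotR_fun w' w.
  by rewrite /dotR_fun dot_sym mulrC.
have lin w' : scalar (dotR_fun^~ w').
  move=> a x y; rewrite /dotR_fun hpartP vpartP dotDl dotZl; ring.
have linr w : scalar (dotR_fun w).
  by move=> a x y; rewrite symf lin !(symf w).
have pos w : w != 0 -> 0 < dotR_fun w w.
  (* Both summands are nonnegative, so a zero sum forces the horizontal and the vertical part to
     vanish. *)
  move=> w0; rewrite lt_neqAle addr_ge0 ?dot_ge0 -?expr2 ?sqr_ge0// andbT.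
  apply: contra w0; rewrite /dotR_fun eq_sym -expr2.
  rewrite paddr_eq0 ?dot_ge0 ?sqr_ge0// => /andP[h].
  rewrite sqrf_eq0 => /eqP v0; have h0 : hpart w = 0.
    by apply/eqP; apply: contraT => /(@neq0_dnorm_gt0 _ _ _ ip); rewrite (eqP h) ltxx.
  apply/eqP/val_inj; rewrite /= -(pairRK (vsval w)) -vsval_hpart h0 -/(vpart w) v0.
  by rewrite linear0 pairRE scale0r addr0; exact: (linear0 pairR0).
pose B := bilinear_isBilinear.Build R (subvs_of (layerR V1)) (subvs_of (layerR V1)) R
   *%R (idfun \; *%R) dotR_fun (lin, linr).
pose H := isHermitianSesquilinear.Build R (subvs_of (layerR V1)) false idfun dotR_fun
  (fun w w' => etrans (symf w w') (esym (mul1r _))).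
pose P := isDotProduct.Build R (subvs_of (layerR V1)) dotR_fun pos.
pose ip' : {dot (subvs_of (layerR V1)) for idfun} := HB.pack dotR_fun B H P.
by exists ip'.
Qed.

End Pairs.

Lemma is_derive_scale (R : realType) (W : normedModType R) (f : R -> R) (e : W)
    (t l : R) :
  is_derive t (1 : R) f l -> is_derive t (1 : R) (fun x => f x *: e) (l *: e).
Proof.
case=> df <-.
have h : (fun h : R => h^-1 *: (f (h *: (1 : R) + t) *: e - f t *: e))
    @ 0^' --> ('D_1 f t) *: e.
  rewrite (_ : (fun _ => _) =
      fun h : R => (h^-1 *: (f (h *: (1 : R) + t) - f t)) *: e); last first.
    by apply/funext => x /=; rewrite -scalerBl scalerA.
  by apply: cvgZr_tmp; exact: df.
by apply: DeriveDef; [apply/cvg_ex; exists ('D_1 f t *: e)|exact: cvg_lim].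
Qed.

Lemma ac_scale (R : realType) (W : normedModType R) (f : R -> R) (e : W)
    (a b : R) :
  absolutely_continuous a b f -> absolutely_continuous a b (fun x => f x *: e).
Proof.
move=> acf d d0; have e1 : 0 < `|e| + 1 by apply: ltr_pwDr.
have [r r0 rP] := acf _ (divr_gt0 d0 e1); exists r => // m I I1 I2 I3.
have := rP m I I1 I2 I3; rewrite ltr_pdivlMr// => /(le_lt_trans _); apply.
rewrite mulr_suml ler_sum// => i _; rewrite -scalerBl normrZ ler_wpM2l//.
by rewrite lerDl.
Qed.

Lemma is_deriveD_fun (R : realType) (W : normedModType R) (f g : R -> W)
    (t : R) l m :
  is_derive t (1 : R) f l -> is_derive t (1 : R) g m ->
  is_derive t (1 : R) (fun x => f x + g x) (l + m).
Proof. by move=> df dg; exact: (@is_deriveD _ _ _ f g t 1 l m df dg). Qed.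

(** * Lipschitz primitives of bounded measurable functions *)

Section Primitive.
Variable R : realType.
Local Notation mu := (@lebesgue_measure R).

(** The primitive of [v] extended by 0 outside [a, b]. It will be the vertical component of a curve
    in the product. *)
Lemma bounded_primitive (v : R -> R) (a b K s : R) : a <= b ->
  measurable_fun `[a, b] v -> (forall t, `|v t| <= K) ->
  exists F : R -> R, [/\ F a = s, F b = s + \int[mu]_(t in `[a, b]) v t,
    (forall x y, x <= y -> `|F y - F x| <= K * (y - x)) &
    {ae mu, forall t, t \in `[a, b] -> is_derive t (1 : R) F (v t)}].
Proof.
move=> ab mv vK.
have K0 : 0 <= K by rewrite (le_trans _ (vK 0)).
have muoo (c : bool) x y : (mu [set` Interval (BSide c x) (BRight y)] < +oo)%E.
  by rewrite lebesgue_measure_itv/=; case: ifP => _; rewrite ?ltry// -EFinD ltry.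
have iv : mu.-integrable `[a, b] (EFin \o v).
  apply/integrableP; split; first exact/measurable_EFinP.
  have mI : measurable (`[a, b]%classic : set (measurableTypeR R)) by exact: measurable_itv.
  apply: (@le_lt_trans _ _ (\int[mu]_(t in `[a, b]) (cst K%:E t))%E).
    apply: ge0_le_integral => //.
    - exact: (measurableT_comp (@abse_measurable R setT) ((measurable_EFinP _ _).2 mv)).
    - by move=> t _; rewrite lee_fin.
  by rewrite (@integral_cst _ _ _ mu _ mI K%:E) lte_mul_pinfty ?lee_fin//; exact: muoo.
pose v' := v \_ `[a, b].
have iv' : mu.-integrable setT (EFin \o v').
  by rewrite /v' -restrict_EFin -integrable_mkcond//.
have iv'y y : mu.-integrable `]-oo, y] (EFin \o v').
  by apply: (integrableS _ _ _ iv').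
have loc : locally_integrable [set: R] v'.
  by apply: (integrable_locally _ iv).
have v'K t : `|v' t| <= K by rewrite /v' patchE; case: ifP => // _; rewrite normr0.
pose G y := \int[mu]_(t in `]-oo, y]) v' t.
have GB x y : x <= y -> G y - G x = \int[mu]_(t in `]x, y]) v' t.
  by move=> xy; rewrite /G Rintegral_itvB ?bnd_simp.
exists (fun y => s + (G y - G a)); split.
- by rewrite subrr addr0.
- rewrite GB// Rintegral_itv_obnd_cbnd; last by apply: (integrableS _ _ _ iv').
  by congr (_ + _); apply: eq_Rintegral => t tab; rewrite /v' patchE tab.
- move=> x y xy; rewrite (_ : _ - _ = G y - G x); last by ring.
  rewrite GB// {GB}.
  have iv'' : mu.-integrable `]x, y] (EFin \o v') by apply: (integrableS _ _ _ iv').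
  have mI : measurable (`]x, y]%classic : set (measurableTypeR R)) by exact: measurable_itv.
  rewrite (le_trans (le_normr_Rintegral mI iv''))//.
  have iK : mu.-integrable `]x, y] (EFin \o cst K).
    apply/integrableP; split; first exact/measurable_EFinP.
    rewrite (@integral_cst _ _ _ mu _ mI `|K|%:E) lte_mul_pinfty ?lee_fin//.
    exact: muoo.
  have -> : K * (y - x) = \int[mu]_(t in `]x, y]) cst K t.
    have mE : mu `]x, y] = (y - x)%:E.
      rewrite lebesgue_measure_itv/= lte_fin.
      by move: xy; rewrite le_eqVlt => /orP[/eqP->|->//]; rewrite ltxx subrr.
    rewrite (Rintegral_cst _ mI); congr (_ * _).
    exact: (esym (congr1 fine mE)).
  apply: le_Rintegral => //.
  exact: integrable_norm iv''.
- have := FTC1Ny iv'y loc.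
  apply: filterS; first exact: (ae_filter_ringOfSetsType mu).
  move=> t [dG G'] tab.
  have iG : is_derive t (1 : R) G (v t).
    have -> : v t = v' t by rewrite /v' patchE mem_set.
    by apply: DeriveDef; [exact: dG|rewrite -derive1E; exact: G'].
  have := @is_deriveD_fun R R (cst (s - G a)) G t 0 (v t) (is_derive_cst _ _ _) iG.
  by rewrite add0r; congr is_derive; apply/funext => x /=; ring.
Qed.

End Primitive.

(** * The sub-Riemannian distance of the product *)

Section ProductDistance.
Variables (R : realType) (n : nat) (br : 'rV[R]_n -> 'rV[R]_n -> 'rV[R]_n).
Hypothesis brH : is_lie_bracket br.
Variables (V1 : {vspace 'rV[R]_n}) (ip : {dot (subvs_of V1) for idfun}).
Variable ip' : {dot (subvs_of (layerR V1)) for idfun}.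
Hypothesis ip'E : forall w w', ip' w w' = dotR_fun ip w w'.
Local Notation mu := (@lebesgue_measure R).
Local Notation I01 := (`[0%R, 1%R]%classic : set R).
Implicit Types (p q : 'rV[R]_n) (s t : R).

Lemma dotR_norm w :
  dot_norm ip' w = Num.sqrt (dot_norm ip (hpart w) ^+ 2 + vpart w ^+ 2).
Proof. by rewrite /dot_norm ip'E /dotR_fun -expr2 sqr_dot_norm. Qed.

Lemma dot_norm_hpart w : dot_norm ip (hpart w) <= dot_norm ip' w.
Proof.
rewrite dotR_norm -[leLHS]ger0_norm ?dot_norm_ge0// -sqrtr_sqr ler_wsqrtr//.
by rewrite lerDl sqr_ge0.
Qed.

Lemma norm_vpart w : `|vpart w| <= dot_norm ip' w.
Proof. by rewrite dotR_norm -sqrtr_sqr ler_wsqrtr// lerDr sqr_ge0. Qed.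

Lemma control_hpart w : is_control ip' w -> is_control ip (fun t => hpart (w t)).
Proof.
move=> [mw [M wM]]; split.
  move=> i; rewrite (_ : (fun _ => _) = fun t => vsval (w t) 0 (lshift 1 i))//.
  by apply/funext => t /=; rewrite vsval_hpart mxE.
exists M; move: wM; apply: filterS; first exact: (ae_filter_ringOfSetsType mu).
by move=> t wM t01 /=; rewrite (le_trans (dot_norm_hpart _))// wM.
Qed.

Lemma horizontal_hpart (w : R -> subvs_of (layerR V1)) g : horizontal_curve (bracketR br) w g ->
  horizontal_curve br (fun t => hpart (w t)) (lsubmx \o g).
Proof.
move=> [acg dg]; split; first exact: (ac_linear (@lsubmx R 1 n 1)).
move: dg; apply: filterS; first exact: (ae_filter_ringOfSetsType mu).
move=> t dg t01; rewrite /= vsval_hpart -lsubmx_dleft//.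
exact: (is_derive_linear (@lsubmx R 1 n 1) (dg t01)).
Qed.

Lemma control_vpart w : is_control ip' w ->
  mu.-integrable I01 (EFin \o (fun t => `|vpart (w t)|)).
Proof.
move=> cw; have [mw _] := cw.
apply: le_integrable (control_integrable cw) => //.
  apply/measurable_EFinP; apply: measurableT_comp => //.
  have -> : (fun t => vpart (w t)) = (fun t => vsval (w t) 0 (rshift n 0)).
    by apply/funext => t; rewrite /vpart mxE.
  exact: mw.
by move=> t _ /=; rewrite lee_fin normr_id (le_trans (norm_vpart _))// ler_norm.
Qed.

(** The mean value inequality applied to the vertical component, whose derivative is the vertical
    part of the control. *)
Lemma vpart_length w g : is_control ip' w ->
  horizontal_curve (bracketR br) w g ->
  `|rsubmx (g 1) 0 0 - rsubmx (g 0) 0 0| <=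
    \int[mu]_(t in I01) `|vpart (w t)|.
Proof.
move=> cw [acg dg].
have -> : rsubmx (g 1) 0 0 - rsubmx (g 0) 0 0 =
    (rsubmx (g 1) - rsubmx (g 0) : 'rV_1) 0 0 by rewrite !mxE.
apply: (le_trans (ler_row_norm _ _)).
apply: (@ac_norm_le_integral _ _ (@rsubmx R 1 n 1 \o g)) => //.
- exact: (ac_linear (@rsubmx R 1 n 1)).
- exact: control_vpart.
- move: dg; apply: filterS; first exact: (ae_filter_ringOfSetsType mu).
  move=> t dg t01; exists (rsubmx (vsval (w t))).
    rewrite -(rsubmx_dleft brH (g t)).
    exact: (is_derive_linear (@rsubmx R 1 n 1) (dg t01)).
  by apply: row_norm_le => // i; rewrite (ord1 i).
Qed.

Lemma hypot_cauchy_schwarz (A B a b : R) : 0 <= A -> 0 <= B ->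
  A * a + B * b <= Num.sqrt (A ^+ 2 + B ^+ 2) * Num.sqrt (a ^+ 2 + b ^+ 2).
Proof.
move=> A0 B0; rewrite (le_trans (ler_norm _))// -sqrtr_sqr -sqrtrM; last first.
  by rewrite addr_ge0// sqr_ge0.
rewrite ler_wsqrtr// -subr_ge0.
rewrite (_ : _ - _ = (A * b - B * a) ^+ 2) ?sqr_ge0//; ring.
Qed.

(** Pairing the speeds with the constant vector [(A, B)] of norm [N] and integrating gives [N ^+ 2 =
    A ^+ 2 + B ^+ 2 <= N * control_length ip' w]; it remains to divide by [N]. *)
Lemma product_length_ge w g : is_control ip' w ->
  horizontal_curve (bracketR br) w g ->
  Num.sqrt (control_length ip (fun t => hpart (w t)) ^+ 2 +
            `|rsubmx (g 1) 0 0 - rsubmx (g 0) 0 0| ^+ 2) <=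
  control_length ip' w.
Proof.
move=> cw hg; set A := control_length ip _; set B := `|_ - _|.
have A0 : 0 <= A by exact: control_length_ge0.
have B0 : 0 <= B by exact: normr_ge0.
set N := Num.sqrt _; have N0 : 0 <= N by exact: sqrtr_ge0.
have [->|Nn0] := eqVneq N 0; first exact: control_length_ge0.
have Np : 0 < N by rewrite lt_neqAle eq_sym Nn0.
have NN : N * N = A * A + B * B by rewrite -expr2 sqr_sqrtr ?addr_ge0 ?sqr_ge0 ?expr2.
rewrite -(ler_pM2l Np) NN.
have mI : measurable (I01 : set (measurableTypeR R)) by exact: measurable_itv.
have iu := control_integrable (control_hpart cw).
have iv := control_vpart cw.
have iw := control_integrable cw.
have iAu := integrableZl mI A iu; have iBv := integrableZl mI B iv.
have iNw := integrableZl mI N iw.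
have h : \int[mu]_(t in I01) (A * dot_norm ip (hpart (w t)) + B * `|vpart (w t)|)
    <= \int[mu]_(t in I01) (N * dot_norm ip' (w t)).
  apply: le_Rintegral => //.
    exact: (integrableD mI iAu iBv).
  move=> t _; rewrite dotR_norm -(real_normK (num_real (vpart _))).
  exact: hypot_cauchy_schwarz.
move: h; rewrite RintegralD// !RintegralZl// => h.
apply: (le_trans _ h); rewrite lerD2l ler_wpM2l//.
exact: vpart_length.
Qed.

Lemma pairR_curve u v g sg : is_control ip u -> horizontal_curve br u g ->
  absolutely_continuous 0 1 sg ->
  {ae mu, forall t, t \in `[0, 1] -> is_derive t (1 : R) sg (v t)} ->
  horizontal_curve (bracketR br) (fun t => mkpair (u t) (v t))
    (fun t => pairR (g t) (sg t)).
Proof.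
move=> cu [acg dg] acs ds.
have E : (fun t => pairR (g t) (sg t)) =
    fun t => (@pairR0 R n \o g) t + sg t *: pairR 0 1.
  by apply/funext => t; rewrite pairRE.
split.
  by rewrite E; apply: acD; [exact: ac_linear|exact: ac_scale].
move: dg ds; apply: filterS2; first exact: (ae_filter_ringOfSetsType mu).
move=> t dg ds t01.
have -> : dleft (bracketR br) (pairR (g t) (sg t)) (vsval (mkpair (u t) (v t))) =
   @pairR0 R n (dleft br (g t) (vsval (u t))) + v t *: pairR 0 1.
  rewrite -[RHS]pairRE; apply: pairR_inj_ext.
    by rewrite lsubmx_dleft// vsval_mkpair !lsubmx_pairR.
  by rewrite rsubmx_dleft// vsval_mkpair !rsubmx_pairR.
rewrite E; apply: is_deriveD_fun; last exact/is_derive_scale/ds.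
exact: (is_derive_linear (@pairR0 R n) (dg t01)).
Qed.

Lemma measurable_pairR (D : set R) (f : R -> 'rV[R]_n) (h : R -> R) :
  (forall i, measurable_fun D (fun t => f t 0 i)) -> measurable_fun D h ->
  forall i, measurable_fun D (fun t => pairR (f t) (h t) 0 i).
Proof.
move=> mf mh i; rewrite -(splitK i); case: (fintype.split i) => j /=.
  have -> : (fun t => pairR (f t) (h t) 0 (lshift 1 j)) = (fun t => f t 0 j).
    by apply/funext => t; rewrite /pairR row_mxEl.
  exact: mf.
have -> : (fun t => pairR (f t) (h t) 0 (rshift n j)) = h.
  by apply/funext => t; rewrite /pairR row_mxEr (ord1 j) mxE eqxx mulr1n.
exact: mh.
Qed.

(* No reparametrization by arc length is needed: it suffices to let the
   vertical speed be proportional to the horizontal one; adding [e] keeps the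
   proportionality factor finite when the horizontal length vanishes. *)
Lemma product_length_le u g p q s t e : is_control ip u ->
  horizontal_curve br u g -> g 0 = p -> g 1 = q -> 0 < e ->
  (sr_dist (bracketR br) ip' (pairR p s) (pairR q t) <=
    (Num.sqrt ((control_length ip u + e) ^+ 2 + (t - s) ^+ 2))%:E)%E.
Proof.
move=> cu0 hg0 g0 g1 e0.
have [u' [M [cu hg uM Lle]]] := bounded_control cu0 hg0.
set L := control_length ip u'.
have L0 : 0 <= L by exact: control_length_ge0.
have Le : 0 < L + e by rewrite ltr_wpDl.
have mI : measurable (I01 : set (measurableTypeR R)) by exact: measurable_itv.
have iu := control_integrable cu.
have m01 : (mu I01 < +oo)%E by rewrite lebesgue_measure_itv/= lte_fin ltr01 ltry.
have ic : mu.-integrable I01 (EFin \o cst e).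
  apply/integrableP; split; first exact/measurable_EFinP.
  by rewrite (@integral_cst _ _ _ mu _ mI `|e|%:E) lte_mul_pinfty ?lee_fin//; exact: m01.
have iue : mu.-integrable I01 (EFin \o (fun x => dot_norm ip (u' x) + e)).
  exact: (integrableD mI iu ic).
(* Since the horizontal speed plus [e] has integral [L + e], this vertical speed leads from [s] to
   [t]. *)
pose v x := (t - s) / (L + e) * (dot_norm ip (u' x) + e).
have mv : measurable_fun I01 v.
  apply: measurable_funM => //.
  apply: measurable_funD => //.
  by apply: measurable_dot_norm => //; case: cu.
have intue : \int[mu]_(x in I01) (dot_norm ip (u' x) + e) = L + e.
  rewrite RintegralD//; congr (_ + _); rewrite (Rintegral_cst _ mI).
  have mE : mu I01 = 1%:E by rewrite lebesgue_measure_itv/= lte_fin ltr01 oppr0 adde0.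
  by rewrite (congr1 fine mE) mulr1.
have intv : \int[mu]_(x in I01) v x = t - s.
  by rewrite /v RintegralZl// intue divfK// gt_eqF.
have vK x : `|v x| <= `|(t - s) / (L + e)| * (M + e).
  rewrite normrM ler_wpM2l// ger0_norm; first by rewrite lerD2r.
  by rewrite addr_ge0 ?dot_norm_ge0// ltW.
have [sg [sg0 sg1 sgK dsg]] := bounded_primitive s (@ler01 R) mv vK.
pose w x := mkpair (u' x) (v x).
pose G x := pairR (g x) (sg x).
have wE x : dot_norm ip' (w x) = Num.sqrt (dot_norm ip (u' x) ^+ 2 + v x ^+ 2).
  by rewrite dotR_norm hpart_mkpair vpart_mkpair.
pose N := Num.sqrt ((L + e) ^+ 2 + (t - s) ^+ 2).
(* Once the horizontal speed is enlarged by [e], the horizontal and vertical speeds are in the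
   constant ratio [L + e] to [t - s], and the total speed is [N / (L + e)] times the former. *)
have wN x : dot_norm ip' (w x) <= N / (L + e) * (dot_norm ip (u' x) + e).
  have ue : 0 <= dot_norm ip (u' x) + e by rewrite addr_ge0 ?dot_norm_ge0// ltW.
  rewrite wE -[leRHS]ger0_norm; last first.
    by rewrite mulr_ge0// divr_ge0 ?sqrtr_ge0// ltW.
  have NN : N ^+ 2 = (L + e) ^+ 2 + (t - s) ^+ 2.
    by rewrite sqr_sqrtr// addr_ge0 ?sqr_ge0.
  rewrite -sqrtr_sqr ler_wsqrtr//.
  have -> : (N / (L + e) * (dot_norm ip (u' x) + e)) ^+ 2 =
      (dot_norm ip (u' x) + e) ^+ 2 + v x ^+ 2.
    rewrite /v !exprMn exprVn NN; field.
    by rewrite gt_eqF.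
  by rewrite lerD2r ler_sqr ?nnegrE ?dot_norm_ge0// lerDl ltW.
have cw : is_control ip' w.
  split.
    move=> i.
    have -> : (fun x => vsval (w x) 0 i) = (fun x => pairR (vsval (u' x)) (v x) 0 i).
      by apply/funext => x; rewrite vsval_mkpair.
    by apply: measurable_pairR => //; case: cu.
  exists (N / (L + e) * (M + e)); apply: aeW => x _.
  rewrite (le_trans (wN x))// ler_wpM2l ?lerD2r//.
  by rewrite divr_ge0 ?sqrtr_ge0// ltW.
have hw : horizontal_curve (bracketR br) w G.
  apply: pairR_curve cu hg _ dsg.
  by apply: lipschitz_ac => x y _ xy _; exact: sgK.
have wL : control_length ip' w <= N.
  have -> : N = \int[mu]_(x in I01) (N / (L + e) * (dot_norm ip (u' x) + e)).
    by rewrite RintegralZl// intue divfK// gt_eqF.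
  apply: le_Rintegral => //; first exact: control_integrable.
  exact: (integrableZl mI _ iue).
apply: (@le_trans _ _ (control_length ip' w)%:E).
  apply: sr_dist_le cw hw _ _.
    by rewrite /G g0 sg0.
  by rewrite /G g1 sg1 intv addrC subrK.
rewrite lee_fin (le_trans wL)// ler_wsqrtr// lerD2r.
by rewrite ler_sqr ?nnegrE ?lerD2r// ltW// ltr_wpDl// control_length_ge0.
Qed.

Lemma sqrte_hypot (r b : R) : 0 <= r ->
  sqrte (r%:E ^+ 2 + (`|b| ^+ 2)%:E)%E = (Num.sqrt (r ^+ 2 + b ^+ 2))%:E.
Proof. by move=> r0; rewrite real_normK ?num_real. Qed.

Lemma sr_dist_product p q s t :
  sr_dist (bracketR br) ip' (pairR p s) (pairR q t) =
  sqrte (sr_dist br ip p q ^+ 2 + (`|t - s| ^+ 2)%:E)%E.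
Proof.
apply/eqP; rewrite eq_le; apply/andP; split; last first.
  (* Lower bound: project a curve of the product to its two components. *)
  apply: sr_dist_ge => w G cw hw G0 G1.
  have hl := product_length_ge cw hw.
  have pq : (sr_dist br ip p q <= (control_length ip (fun t => hpart (w t)))%:E)%E.
    apply: (sr_dist_le (control_hpart cw) (horizontal_hpart hw)).
      by rewrite /= G0 lsubmx_pairR.
    by rewrite /= G1 lsubmx_pairR.
  move: (sr_dist_ge0 br ip p q) pq.
  case E : (sr_dist br ip p q) => [r| |]//; rewrite !lee_fin => r0 rl.
  rewrite -expr2 (le_trans _ hl)// ler_wsqrtr// lerD//.
    by rewrite ler_sqr ?nnegrE ?control_length_ge0.
  by rewrite G0 G1 !rsubmx_pairR !mxE !eqxx !mulr1n.
have := sr_dist_ge0 br ip p q.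
case E : (sr_dist br ip p q) => [r| |]; last 2 first.
- by move=> _; rewrite expe2 mulyy addye//= leey.
- by rewrite leeNy_eq.
rewrite lee_fin => r0; rewrite sqrte_hypot//.
(* Half of [e] goes into the choice of an almost minimizing control, half into the error of
   [product_length_le]. *)
apply/lee_addgt0Pr => e e0.
have e2 : 0 < e / 2 by rewrite divr_gt0.
have [|u [g [cu hg [g0 g1] ul]]] := @sr_dist_lt _ _ br _ ip (r + e / 2) p q.
  by rewrite E lte_fin ltrDl.
apply: (le_trans (product_length_le s t cu hg g0 g1 e2)).
rewrite -EFinD lee_fin.
set L := control_length ip u in ul *.
have L0 : 0 <= L by exact: control_length_ge0.
rewrite -(@ler_pXn2r _ 2%N)// ?nnegrE ?addr_ge0 ?sqrtr_ge0 ?(ltW e0)//.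
have r2 : 0 <= r ^+ 2 + (t - s) ^+ 2 by rewrite addr_ge0 ?sqr_ge0.
have L2 : 0 <= (L + e / 2) ^+ 2 + (t - s) ^+ 2 by rewrite addr_ge0 ?sqr_ge0.
rewrite [X in _ <= X]sqrrD !sqr_sqrtr//.
(* With [b = t - s], this gives [sqrt((r + e)^2 + b^2) <= sqrt(r^2 + b^2) + e] after squaring. *)
have rs : r <= Num.sqrt (r ^+ 2 + (t - s) ^+ 2).
  by rewrite -[leLHS]ger0_norm// -sqrtr_sqr ler_wsqrtr// lerDl sqr_ge0.
have : (L + e / 2) ^+ 2 <= (r + e) ^+ 2.
  by rewrite ler_sqr ?nnegrE ?addr_ge0// ?ltW//; lra.
have := ler_wpM2r (ltW e0) rs.
by rewrite mulr2n; lra.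
Qed.

End ProductDistance.

(** * Dilations *)
Section Stratification.
Variables (R : realType) (n : nat) (br : 'rV[R]_n -> 'rV[R]_n -> 'rV[R]_n).
Variable V : nat -> {vspace 'rV[R]_n}.
Hypothesis brH : is_lie_bracket br.
Hypothesis stV : is_stratification br 3 V.

Lemma span_ind (P : 'rV[R]_n -> Prop) (X : seq 'rV[R]_n) :
  P 0 -> (forall a u v, P u -> P v -> P (a *: u + v)) ->
  {in X, forall v, P v} -> {in <<X>>%VS, forall v, P v}.
Proof.
move=> P0 PD PX v vX; rewrite (@coord_span _ _ _ (in_tuple X) v vX); elim/big_rec : _ => // i w _ Pw.
by apply: PD => //; apply: PX; rewrite mem_nth.
Qed.

Lemma mem_lie_prod (U W : {vspace 'rV[R]_n}) x y :
  x \in U -> y \in W -> br x y \in lie_prod br U W.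
Proof.
move=> xU yW; rewrite (coord_vbasis xU) (br_suml brH); apply: rpred_sum => i _.
rewrite (brZl brH) rpredZ// (coord_vbasis yW) (br_sumr brH).
apply: rpred_sum => j _; rewrite (brZr brH) rpredZ//; apply: memv_span.
by apply: allpairs_f; rewrite mem_nth// size_tuple.
Qed.

Lemma br_V1_V1 x y : x \in V 1%N -> y \in V 1%N -> br x y \in V 2%N.
Proof. by move=> x1 y1; rewrite -(strat_generated stV)// mem_lie_prod. Qed.

Lemma br_V1_V2 x y : x \in V 1%N -> y \in V 2%N -> br x y \in V 3%N.
Proof. by move=> x1 y1; rewrite -(strat_generated stV)// mem_lie_prod. Qed.

Lemma br_V1_V3 x y : x \in V 1%N -> y \in V 3%N -> br x y = 0.
Proof.
move=> x1 y1; apply/eqP; rewrite -memv0 -(strat_nilpotent stV).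
exact: mem_lie_prod.
Qed.

Lemma V2_ind (P : 'rV[R]_n -> Prop) :
  P 0 -> (forall a u v, P u -> P v -> P (a *: u + v)) ->
  (forall x y, x \in V 1%N -> y \in V 1%N -> P (br x y)) ->
  {in V 2%N, forall v, P v}.
Proof.
move=> P0 PD Pbr; rewrite -(strat_generated stV (i := 1))//; apply: span_ind => //.
by move=> _ /allpairsP[[x y] [/vbasis_mem x1 /vbasis_mem y1 ->]]; exact: Pbr.
Qed.

Lemma V3_ind (P : 'rV[R]_n -> Prop) :
  P 0 -> (forall a u v, P u -> P v -> P (a *: u + v)) ->
  (forall x y, x \in V 1%N -> y \in V 2%N -> P (br x y)) ->
  {in V 3%N, forall v, P v}.
Proof.
move=> P0 PD Pbr; rewrite -(strat_generated stV (i := 2))//; apply: span_ind => //.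
by move=> _ /allpairsP[[x y] [/vbasis_mem x1 /vbasis_mem y1 ->]]; exact: Pbr.
Qed.

(** The Jacobi identity in Leibniz form: [br x] is a derivation. *)
Lemma br_jacobi x y z : br x (br y z) = br (br x y) z + br y (br x z).
Proof.
apply/eqP; rewrite -subr_eq0 -(lie_jacobi brH x y z).
rewrite (br_anti brH (br x y) z) (br_anti brH x z) (brNr brH) opprD.
by rewrite addrA addrAC.
Qed.

(** The second layer is spanned by brackets of the first, which annihilates the third; the Leibniz
    form transfers this to the second. *)
Lemma br_V2_V3 x y : x \in V 2%N -> y \in V 3%N -> br x y = 0.
Proof.
move=> x2 y3; move: x x2; apply: V2_ind.
- exact: br0l.
- by move=> a u v u0 v0; rewrite (brDl brH) (brZl brH) u0 v0 scaler0 addr0.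
- move=> x z x1 z1; have := br_jacobi x z y.
  by rewrite (br_V1_V3 z1 y3) (br_V1_V3 x1 y3) !(br0r brH) addr0 => /esym.
Qed.

(** The projection onto the layer [V i.+1]: the ordinals start from 0, the layers from 1. *)
Definition layer_pi (i : 'I_3) :=
  sumv_pi_for (P := xpredT) (Vs := fun i : 'I_3 => V i.+1) (esym (strat_full stV)) i.

Lemma layer_pi_sum x : \sum_i layer_pi i x = x.
Proof. by rewrite /layer_pi sumv_pi_sum// memvf. Qed.

Lemma layer_pi_mem i x : layer_pi i x \in V i.+1.
Proof. exact: memv_sum_pi. Qed.

Lemma layer_pi_id (i j : 'I_3) x : x \in V i.+1 ->
  layer_pi j x = if j == i then x else 0.
Proof.
move=> xi.
have := (directv_sum_unique (strat_direct stV)).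
move=> /(_ (fun j => layer_pi j x) (fun j => if j == i then x else 0)).
rewrite layer_pi_sum -big_mkcond big_pred1_eq eqxx.
move=> /(_ (fun k _ => layer_pi_mem k x)) h.
have /h : forall k : 'I_3, true -> (if k == i then x else 0) \in V k.+1.
  by move=> k _; case: eqP => [->//|_]; exact: rpred0.
by move=> /esym/forall_inP /(_ j isT)/eqP.
Qed.

(** The third layer is central. The stratification gives this against the first layer; the Leibniz
    form extends it to the second and then to the third, and the three layers span. *)
Lemma br_V3r a w : w \in V 3%N -> br a w = 0.
Proof.
move=> w3.
have P3 : {in V 3%N, forall v, br v w = 0}.
  apply: V3_ind; first exact: br0l.
    by move=> c u v u0 v0; rewrite (brDl brH) (brZl brH) u0 v0 scaler0 addr0.
  move=> x z x1 z2; have := br_jacobi x z w.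
  by rewrite (br_V2_V3 z2 w3) (br_V1_V3 x1 w3) !(br0r brH) addr0 => /esym.
rewrite -(layer_pi_sum a) (br_suml brH) big1// => i _.
have := layer_pi_mem i a; case: i => -[|[|[|//]]] i3 /= h.
- exact: br_V1_V3.
- exact: br_V2_V3.
- exact: P3.
Qed.

Lemma br_V3l a w : w \in V 3%N -> br w a = 0.
Proof. by move=> w3; rewrite (br_anti brH a w) br_V3r// oppr0. Qed.

(** The anisotropic dilation of the stratified group, of weight [i.+1] on the layer [V i.+1]. *)
Definition dilation (l : R) (x : 'rV[R]_n) :=
  \sum_(i < 3) l ^+ i.+1 *: layer_pi i x.

Lemma dilation_linear l : linear (dilation l).
Proof.
move=> a x y; rewrite /dilation scaler_sumr -big_split; apply: eq_bigr => i _.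
by rewrite linearP scalerDr !scalerA mulrC.
Qed.

Lemma dilationP l a x y :
  dilation l (a *: x + y) = a *: dilation l x + dilation l y.
Proof. exact: dilation_linear. Qed.

Lemma dilation0 l : dilation l 0 = 0.
Proof. by rewrite /dilation big1// => i _; rewrite linear0 scaler0. Qed.

Lemma dilation_layer l (i : 'I_3) x : x \in V i.+1 -> dilation l x = l ^+ i.+1 *: x.
Proof.
move=> xi; rewrite /dilation (bigD1 i)//= big1 ?addr0.
  by rewrite (layer_pi_id _ xi) eqxx.
by move=> j /negPf ji; rewrite (layer_pi_id _ xi) ji scaler0.
Qed.

Lemma dilation_V1 l x : x \in V 1%N -> dilation l x = l *: x.
Proof. by move=> x1; rewrite (@dilation_layer l 0). Qed.

Lemma dilation_V3 l x : x \in V 3%N -> dilation l x = l ^+ 3 *: x.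
Proof. exact: (@dilation_layer l (@Ordinal 3 2 isT)). Qed.

Lemma dilationD l x y : dilation l (x + y) = dilation l x + dilation l y.
Proof. by have := dilationP l 1 x y; rewrite !scale1r. Qed.
Lemma dilationZ l a x : dilation l (a *: x) = a *: dilation l x.
Proof. by have := dilationP l a x 0; rewrite dilation0 !addr0. Qed.
Lemma dilationN l x : dilation l (- x) = - dilation l x.
Proof. by rewrite -scaleN1r dilationZ scaleN1r. Qed.

(** By linearity [x] may be taken in a single layer. The bracket with [v] then raises the weight by
    one, and gives 0 on the third layer. *)
Lemma dilation_br_V1 l x v : v \in V 1%N ->
  dilation l (br x v) = br (dilation l x) (dilation l v).
Proof.
move=> v1; rewrite (dilation_V1 _ v1) (brZr brH).
suff layer (i : 'I_3) z : z \in V i.+1 ->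
    dilation l (br z v) = l *: br (l ^+ i.+1 *: z) v.
  pose D : {linear 'rV[R]_n -> 'rV[R]_n} :=
    HB.pack (dilation l) (GRing.isLinear.Build _ _ _ _ (dilation l) (@dilation_linear l)).
  rewrite -{1}(layer_pi_sum x) (br_suml brH).
  rewrite -[LHS]/(D _) linear_sum /dilation (br_suml brH).
  by rewrite scaler_sumr; apply: eq_bigr => i _; exact: layer (layer_pi_mem i x).
rewrite (brZl brH) scalerA -exprS (br_anti brH v z) scalerN dilationN => zi.
congr (- _); case: i zi => -[|[|[|//]]] i3 /= zi.
- exact: (@dilation_layer l (@Ordinal 3 1 isT)) (br_V1_V1 v1 zi).
- exact: (@dilation_layer l (@Ordinal 3 2 isT)) (br_V1_V2 v1 zi).
- by rewrite (br_V1_V3 v1 zi) dilation0 scaler0.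
Qed.

(** The vectors [y] that satisfy this for every [x] form a subspace. It contains the first layer
    and, by the Leibniz form, is stable under brackets with first-layer vectors, so it is
    everything. *)
Lemma dilation_br l x y : dilation l (br x y) = br (dilation l x) (dilation l y).
Proof.
pose P y := forall x, dilation l (br x y) = br (dilation l x) (dilation l y).
have P0 : P 0 by move=> z; rewrite (br0r brH) dilation0 (br0r brH).
have PD a u v : P u -> P v -> P (a *: u + v).
  move=> Pu Pv z.
  by rewrite (brDr brH) (brZr brH) !dilationP Pu Pv (brDr brH) (brZr brH).
have P1 : {in V 1%N, forall v, P v} by move=> v v1 z; exact: dilation_br_V1.
have Pbr a b : a \in V 1%N -> P b -> P (br a b).
  move=> a1 Pb z.
  have E1 : dilation l (br (br z a) b) =
      br (br (dilation l z) (dilation l a)) (dilation l b).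
    by rewrite Pb (P1 a a1).
  have E2 : dilation l (br a (br z b)) =
      br (dilation l a) (br (dilation l z) (dilation l b)).
    by rewrite (br_anti brH (br z b) a) dilationN (P1 a a1) Pb -(br_anti brH).
  by rewrite br_jacobi dilationD E1 E2 Pb -br_jacobi.
have P2 : {in V 2%N, forall v, P v} by apply: V2_ind => // a b a1 /P1; exact: Pbr.
have P3 : {in V 3%N, forall v, P v} by apply: V3_ind => // a b a1 /P2; exact: Pbr.
suff : P y by exact.
rewrite -(layer_pi_sum y); elim/big_rec : _ => // i z _ Pz.
rewrite -[layer_pi _ _]scale1r; apply: PD => //.
have := layer_pi_mem i y; case: i => -[|[|[|//]]] i3 /=; [exact: P1|exact: P2|exact: P3].
Qed.

Lemma dilation_dleft l x v : v \in V 1%N ->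
  dilation l (dleft br x v) = dleft br (dilation l x) (l *: v).
Proof.
move=> v1; rewrite !(dleftE brH) /dbch !dilationD !dilationZ !dilation_br.
by rewrite (dilation_V1 l v1).
Qed.

Variable ip : {dot (subvs_of (V 1%N)) for idfun}.

Lemma control_scale l u : is_control ip u -> is_control ip (fun t => l *: u t).
Proof.
move=> [mu_ [M uM]]; split.
  move=> i.
  have -> : (fun t => vsval (l *: u t) 0 i) = (fun t => l * vsval (u t) 0 i).
    by apply/funext => t; rewrite linearZ mxE.
  by apply: measurable_funM.
exists (`|l| * M); move: uM; apply: filterS; first exact: (ae_filter_ringOfSetsType (@lebesgue_measure R)).
by move=> t uM t01; rewrite dot_normZ ler_wpM2l// uM.
Qed.

Lemma control_length_scale l u : is_control ip u ->
  control_length ip (fun t => l *: u t) = `|l| * control_length ip u.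
Proof.
move=> cu; rewrite /control_length -RintegralZl//; last exact: control_integrable.
by apply: eq_Rintegral => t _; rewrite dot_normZ.
Qed.

Lemma horizontal_dilation l (u : R -> subvs_of (V 1%N)) g :
  horizontal_curve br u g ->
  horizontal_curve br (fun t => l *: u t) (dilation l \o g).
Proof.
pose D : {linear 'rV[R]_n -> 'rV[R]_n} :=
  HB.pack (dilation l) (GRing.isLinear.Build _ _ _ _ (dilation l) (@dilation_linear l)).
move=> [acg dg]; split; first exact: (ac_linear D).
move: dg; apply: filterS; first exact: (ae_filter_ringOfSetsType (@lebesgue_measure R)).
move=> t dg t01; have -> : vsval (l *: u t) = l *: vsval (u t) by exact: linearZ.
rewrite -dilation_dleft ?subvsP//.
exact: (is_derive_linear D (dg t01)).
Qed.

Lemma sr_dist_dilation_le l z : l != 0 -> z \in V 3%N ->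
  (`|l|^-1%:E * sr_dist br ip 0%R (l ^+ 3 *: z) <= sr_dist br ip 0%R z)%E.
Proof.
move=> l0 z3; apply: sr_dist_ge => u g cu hg g0 g1.
rewrite -(@lee_pmul2l _ `|l|%:E) ?lte_fin ?normr_gt0//.
rewrite muleA -EFinM divff ?normr_eq0// mul1e -EFinM.
rewrite -control_length_scale//.
apply: sr_dist_le (control_scale l cu) (horizontal_dilation l hg) _ _.
  by rewrite /= g0 dilation0.
by rewrite /= g1 dilation_V3.
Qed.

Lemma sr_dist_dilation l z : l != 0 -> z \in V 3%N ->
  (sr_dist br ip 0%R (l ^+ 3 *: z) = `|l|%:E * sr_dist br ip 0%R z)%E.
Proof.
move=> l0 z3; apply/eqP; rewrite eq_le; apply/andP; split.
  have := sr_dist_dilation_le l0 z3.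
  rewrite -(@lee_pmul2l _ `|l|%:E) ?lte_fin ?normr_gt0//.
  by rewrite muleA -EFinM divff ?normr_eq0// mul1e.
(* The reverse inequality is the same one for the inverse dilation. *)
have := @sr_dist_dilation_le l^-1 (l ^+ 3 *: z).
rewrite scalerA -exprMn mulVf// expr1n scale1r normfV invrK; apply.
  by rewrite invr_eq0.
exact: rpredZ.
Qed.

End Stratification.

(** * Distances to points of the third layer *)
Section PolynomialCurves.
Variable R : realType.
Implicit Types p : {poly R}.

(** Induction along the Horner scheme; the bound on the values is carried along because the
    increment of a product needs it. *)
Lemma poly_lipschitz p : exists2 K, 0 <= K & forall x y, `|x| <= 1 -> `|y| <= 1 ->
  `|p.[x]| <= K /\ `|p.[x] - p.[y]| <= K * `|x - y|.
Proof.
elim/poly_ind: p => [|p c [K K0 KP]].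
  by exists 0 => // x y _ _; rewrite !horner0 subrr normr0 mul0r.
exists (K + K + `|c|); first by rewrite !addr_ge0.
move=> x y x1 y1; have [px pxy] := KP x y x1 y1; have [py _] := KP y x y1 x1.
rewrite !hornerMXaddC; split.
  rewrite (le_trans (ler_normD _ _))// lerD2r normrM.
  by rewrite (@le_trans _ _ (K * 1)) ?ler_pM// mulr1 lerDl.
rewrite (_ : _ - _ = (p.[x] - p.[y]) * x + p.[y] * (x - y)); last by ring.
rewrite (le_trans (ler_normD _ _))// !normrM.
have := ler_wpM2r (normr_ge0 (x - y)) py.
have h : `|p.[x] - p.[y]| * `|x| <= K * `|x - y|.
  by rewrite -[leRHS]mulr1 ler_pM.
have : 0 <= `|c| * `|x - y| by rewrite mulr_ge0.
by rewrite !mulrDl; lra.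
Qed.

(** The substitution carries the time interval [0, 1] onto [-1, 1], where the polynomials below have
    their symmetries. *)
Lemma is_derive_horner_affine p (t : R) :
  is_derive t (1 : R) (fun s => p.[2 * s - 1]) (2 * p^`().[2 * t - 1]).
Proof.
pose q := p \Po (2%:P * 'X - 1%:P).
have -> : (fun s => p.[2 * s - 1]) = horner q.
  by apply/funext => s; rewrite /q horner_comp !hornerE.
have -> : 2 * p^`().[2 * t - 1] = q^`().[t].
  rewrite /q deriv_comp hornerM horner_comp !poly.derivE !hornerE; ring.
by apply: DeriveDef; [exact: derivable_horner|rewrite -derive1E -derive.derivE].
Qed.

Lemma affine_unit (t : R) : 0 <= t -> t <= 1 -> `|2 * t - 1| <= 1.
Proof. by move=> t0 t1; rewrite ler_norml; apply/andP; split; lra. Qed.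

Lemma ac_poly p : absolutely_continuous 0 1 (fun s : R => p.[2 * s - 1]).
Proof.
have [K K0 KP] := poly_lipschitz p.
apply: (@lipschitz_ac _ _ _ _ _ (2 * K)) => s t s0 st t1.
have [_] := KP _ _ (affine_unit (le_trans s0 st) t1) (affine_unit s0 (le_trans st t1)).
move=> /le_trans; apply.
have -> : 2 * t - 1 - (2 * s - 1) = 2 * (t - s) by ring.
by rewrite normrM !ger0_norm ?subr_ge0// mulrCA mulrA.
Qed.

Lemma continuous_poly_affine p : continuous (fun s : R => p.[2 * s - 1]).
Proof.
move=> t; apply: differentiable_continuous; apply/derivable1_diffP.
by have [] := is_derive_horner_affine p t.
Qed.

(* Coefficients, as polynomials in s in [-1, 1], of a horizontal curve along x,
   y, [x, y], [x, [x, y]] and [y, [x, y]].  The coefficient pf is even and pg is odd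
   and orthogonal to s, so that pA and pQ vanish again at s = 1; one has
   pA = 3 s (1 - s^2)^3, and pP' = (1 - s^2)^4 / 2 has nonzero integral. *)
Definition pf : {poly R} := 1%:P - 'X^2.
Definition pg : {poly R} := 6 *: 'X - 20 *: 'X^3 + 14 *: 'X^5.
Definition pA : {poly R} := 3 *: 'X - 9 *: 'X^3 + 9 *: 'X^5 - 3 *: 'X^7.
Definition pP : {poly R} := (64 / 315)%:P + 2^-1 *: 'X - (2 / 3) *: 'X^3
  + (3 / 5) *: 'X^5 - (2 / 7) *: 'X^7 + 18^-1 *: 'X^9.
Definition pQ : {poly R} := - (3^-1)%:P - 3 *: 'X^2 + 20 *: 'X^4
  - (130 / 3) *: 'X^6 + 45 *: 'X^8 - 23 *: 'X^10 + (14 / 3) *: 'X^12.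

(** This identity, [pP_deriv] and [pQ_deriv] are the components along [x, y], [x, [x, y]] and [y,
    [x, y]] of the equation of a horizontal curve whose first-layer coordinates are [pf] and
    [pg]. *)
Lemma pA_deriv s :
  pA^`().[s] = (pf.[s] * pg^`().[s] - pg.[s] * pf^`().[s]) / 2.
Proof. by rewrite /pA /pf /pg !(derivB, derivN, derivD, derivZ, derivXn, derivX, derivC)
  !(hornerD, hornerN, hornerZ, hornerMn, hornerXn, hornerX, hornerC)/=; field. Qed.

Lemma pP_deriv s :
  pP^`().[s] = - (pA.[s] * pf^`().[s]) / 2 + pA^`().[s] * pf.[s] / 6.
Proof. by rewrite /pP /pA /pf !(derivB, derivN, derivD, derivZ, derivXn, derivX, derivC)
  !(hornerD, hornerN, hornerZ, hornerMn, hornerXn, hornerX, hornerC)/=; field. Qed.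

Lemma pQ_deriv s :
  pQ^`().[s] = - (pA.[s] * pg^`().[s]) / 2 + pA^`().[s] * pg.[s] / 6.
Proof. by rewrite /pQ /pA /pg !(derivB, derivN, derivD, derivZ, derivXn, derivX, derivC)
  !(hornerD, hornerN, hornerZ, hornerMn, hornerXn, hornerX, hornerC)/=; field. Qed.

Lemma poly_m1 : [/\ pf.[-1] = 0, pg.[-1] = 0, pA.[-1] = 0, pP.[-1] = 0 & pQ.[-1] = 0].
Proof. by rewrite /pP /pA /pf /pg /pQ !(hornerD, hornerN, hornerZ, hornerMn, hornerXn, hornerX, hornerC)/=;
  split; field. Qed.

(** Only the coefficient of [x, [x, y]] survives at the end; 128 / 315 is the integral of [pP'] over
    [-1, 1]. *)
Lemma poly_1 :
  [/\ pf.[1] = 0, pg.[1] = 0, pA.[1] = 0, pP.[1] = 128 / 315 & pQ.[1] = 0].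
Proof. by rewrite /pP /pA /pf /pg /pQ !(hornerD, hornerN, hornerZ, hornerMn, hornerXn, hornerX, hornerC)/=;
  split; field. Qed.

End PolynomialCurves.

(** * A nonzero point of the third layer at finite distance *)

Section Finiteness.
Variables (R : realType) (n : nat) (br : 'rV[R]_n -> 'rV[R]_n -> 'rV[R]_n).
Variable V : nat -> {vspace 'rV[R]_n}.
Hypothesis brH : is_lie_bracket br.
Hypothesis stV : is_stratification br 3 V.
Variable ip : {dot (subvs_of (V 1%N)) for idfun}.
Local Notation mu := (@lebesgue_measure R).
Local Notation I01 := (`[0%R, 1%R]%classic : set R).

(* If [[x, [x, y]]] vanished identically on the first layer, the triple bracket
   would be totally antisymmetric there, hence zero by the Jacobi identity. *)
Lemma exists_double_bracket : exists x y,
  [/\ x \in V 1%N, y \in V 1%N & br x (br x y) != 0].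
Proof.
apply: contrapT => none.
have T0 x y : x \in V 1%N -> y \in V 1%N -> br x (br x y) = 0.
  by move=> x1 y1; apply/eqP; apply: contrapT => /negP h; apply: none; exists x, y.
(* Polarization of [T0] in its repeated variable. *)
have pol x y z : x \in V 1%N -> y \in V 1%N -> z \in V 1%N ->
    br x (br z y) = - br z (br x y).
  move=> x1 y1 z1; have := T0 (x + z) y (rpredD x1 z1) y1.
  rewrite !(brDl brH) !(brDr brH) (T0 x y)// (T0 z y)// addr0 add0r => /eqP.
  by rewrite addr_eq0 => /eqP.
(* By antisymmetry the three terms of the Jacobi identity coincide, so three times the bracket is
   0. *)
have T x y z : x \in V 1%N -> y \in V 1%N -> z \in V 1%N -> br x (br y z) = 0.
  move=> x1 y1 z1; have := lie_jacobi brH x y z.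
  rewrite (br_anti brH x z) (brNr brH) (pol y z x)// opprK.
  rewrite (br_anti brH y x) (brNr brH) (pol z x y)// opprK.
  rewrite (br_anti brH x z) (brNr brH) (pol y z x)// opprK.
  rewrite -mulr2n -mulrSr => /eqP; rewrite -scaler_nat scaler_eq0 pnatr_eq0 /=.
  by move/eqP.
move: (strat_nonzero stV) => /negP; apply.
rewrite -subv0; apply/subvP => v; rewrite memv0 => v3; apply/eqP; move: v v3.
apply: (V3_ind stV) => //.
  by move=> a u v -> ->; rewrite scaler0 addr0.
move=> x y x1; move: y; apply: (V2_ind stV).
- exact: br0r.
- by move=> a u v u0 v0; rewrite (brDr brH) (brZr brH) u0 v0 scaler0 addr0.
- by move=> y z y1 z1; exact: T.
Qed.

Lemma poly_control (a b : subvs_of (V 1%N)) (p q : {poly R}) :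
  is_control ip (fun t => p.[2 * t - 1] *: a + q.[2 * t - 1] *: b).
Proof.
have mp (r : {poly R}) : measurable_fun I01 (fun s : R => r.[2 * s - 1]).
  apply: measurable_funTS; apply: continuous_measurable_fun.
  exact: continuous_poly_affine.
split.
  move=> i.
  have -> : (fun t => vsval (p.[2 * t - 1] *: a + q.[2 * t - 1] *: b) 0 i) =
    (fun t => p.[2 * t - 1] * vsval a 0 i + q.[2 * t - 1] * vsval b 0 i).
    by apply/funext => t; rewrite linearD !linearZ !mxE.
  by apply: measurable_funD; apply: measurable_funM.
have [K K0 KP] := poly_lipschitz p; have [L L0 LP] := poly_lipschitz q.
exists (K * dot_norm ip a + L * dot_norm ip b); apply: aeW => t /=.
rewrite in_itv/= => /andP[t0 t1]; have t2 := affine_unit t0 t1.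
rewrite (le_trans (dot_normD _ _ _))// !dot_normZ lerD// ler_wpM2r ?dot_norm_ge0//.
  by case: (KP _ _ t2 t2).
by case: (LP _ _ t2 t2).
Qed.

Lemma exists_finite_V3 : exists z, [/\ z \in V 3%N, z != 0 &
  (sr_dist br ip 0%R z < +oo)%E].
Proof.
have [x [y [x1 y1 X0]]] := exists_double_bracket.
set Z := br x y; set X := br x Z in X0; set Y := br y Z.
have Z2 : Z \in V 2%N by exact: (br_V1_V1 brH stV).
have X3 : X \in V 3%N by exact: (br_V1_V2 brH stV).
have Y3 : Y \in V 3%N by exact: (br_V1_V2 brH stV).
exists ((128 / 315) *: X); split; first exact: rpredZ.
  by rewrite scaler_eq0 (negPf X0) orbF; apply: lt0r_neq0; lra.
(* The factor 2 is the derivative of [2 * t - 1]. *)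
pose u t := (2 *: (pf R)^`()).[2 * t - 1] *: vsproj (V 1%N) x +
            (2 *: (pg R)^`()).[2 * t - 1] *: vsproj (V 1%N) y.
pose g t := (pf R).[2 * t - 1] *: x + ((pg R).[2 * t - 1] *: y +
   ((pA R).[2 * t - 1] *: Z + ((pP R).[2 * t - 1] *: X + (pQ R).[2 * t - 1] *: Y))).
apply: (@le_lt_trans _ _ (control_length ip u)%:E); last by rewrite ltry.
apply: (@sr_dist_le _ _ _ _ _ _ _ u g).
- exact: poly_control.
- split.
    by do 4 (apply: acD; first by apply: ac_scale; exact: ac_poly);
      apply: ac_scale; exact: ac_poly.
  apply: aeW => t _.
  have uE : vsval (u t) = (2 * (pf R)^`().[2 * t - 1]) *: x +
                          (2 * (pg R)^`().[2 * t - 1]) *: y.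
    rewrite /u linearD !hornerZ; congr (_ + _); rewrite linearZ_LR;
      congr (_ *: _); exact: vsprojK.
  have -> : dleft br (g t) (vsval (u t)) = (2 * (pf R)^`().[2 * t - 1]) *: x +
     ((2 * (pg R)^`().[2 * t - 1]) *: y + ((2 * (pA R)^`().[2 * t - 1]) *: Z +
     ((2 * (pP R)^`().[2 * t - 1]) *: X + (2 * (pQ R)^`().[2 * t - 1]) *: Y))).
    rewrite pP_deriv pQ_deriv pA_deriv (dleftE brH) uE /dbch /g.
    set s := 2 * t - 1; set f := (pf R).[s]; set f' := (pf R)^`().[s].
    set h := (pg R).[s]; set h' := (pg R)^`().[s]; set A := (pA R).[s].
    set P := (pP R).[s]; set Q := (pQ R).[s].
    set G := f *: x + _; set U := _ + _ *: y.
    have GU : br G U = (2 * (f * h' - h * f')) *: Z - (2 * A * f') *: X - (2 * A * h') *: Y.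
      rewrite /G /U !(brDl brH) !(brDr brH) !(brZl brH) !(brZr brH).
      rewrite !(lie_alternating brH) (br_anti brH x y) -/Z.
      rewrite (br_anti brH x Z) (br_anti brH y Z) -/X -/Y.
      rewrite !(br_V3l brH stV _ X3) !(br_V3l brH stV _ Y3).
      by apply/rowP => i; rewrite !mxE; ring.
    (* [X] and [Y] are central, so only the component of [br G U] along [Z] contributes, bracketed
       with the first-layer part of [G]. *)
    have GGU : br G (br G U) = (2 * (f * h' - h * f')) *: (f *: X + h *: Y).
      rewrite GU !(brDr brH) !(brNr brH) !(brZr brH).
      rewrite (br_V3r brH stV _ X3) (br_V3r brH stV _ Y3).
      rewrite /G !(brDl brH) !(brZl brH) -/X -/Y.
      rewrite (br_V3l brH stV _ X3) (br_V3l brH stV _ Y3) (lie_alternating brH).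
      by apply/rowP => i; rewrite !mxE; ring.
    rewrite GGU GU /U.
    by apply/rowP => i; rewrite !mxE; field.
  by do 4 (apply: is_deriveD_fun;
    first by apply: is_derive_scale; exact: is_derive_horner_affine);
    apply: is_derive_scale; exact: is_derive_horner_affine.
- rewrite /g mulr0 sub0r; have [-> -> -> -> ->] := poly_m1 R.
  by rewrite !scale0r !addr0.
- rewrite /g (_ : 2 * 1 - 1 = 1); last by ring.
  have [-> -> -> -> ->] := poly_1 R.
  by rewrite !scale0r !add0r addr0.
Qed.

End Finiteness.

(** * Positivity of the distance from 0 to another point *)

Section Positivity.
Variables (R : realType) (n : nat) (br : 'rV[R]_n -> 'rV[R]_n -> 'rV[R]_n).
Hypothesis brH : is_lie_bracket br.
Variables (V1 : {vspace 'rV[R]_n}) (ip : {dot (subvs_of V1) for idfun}).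
Local Notation mu := (@lebesgue_measure R).
Local Notation I01 := (`[0%R, 1%R]%classic : set R).

(** [T] is the infimum of the times at which the norm is at least [r]. The norm is below [r] before
    [T], and continuity settles [T] itself; the slack 1 in the last bound avoids proving equality
    there. *)
Lemma first_hitting_time (W : normedModType R) (g : R -> W) (r : R) :
  absolutely_continuous 0 1 g -> g 0 = 0 -> 0 < r -> r <= `|g 1| ->
  exists T, [/\ 0 <= T, T <= 1, r <= `|g T| &
    forall t, 0 <= t -> t <= T -> `|g t| <= r + 1].
Proof.
move=> acg g0 r0 rg.
pose S := [set t | 0 <= t <= 1 /\ r <= `|g t|].
have S1 : S 1 by split=> //; rewrite ler01 lexx.
have infS : has_inf S by split; [exists 1 | exists 0 => t [/andP[]]].
pose T := inf S.
have T0 : 0 <= T by apply: lb_le_inf; [exists 1|move=> t [/andP[]]].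
have T1 : T <= 1 by apply: ge_inf => //; case: infS.
have below t : 0 <= t -> t < T -> `|g t| < r.
  move=> t0 tT; rewrite ltNge; apply/negP => rt.
  have : T <= t.
    apply: ge_inf; first by case: infS.
    by split=> //; rewrite t0/=; apply: le_trans (ltW tT) T1.
  by rewrite leNgt tT.
have gT : r <= `|g T|.
  apply/ler_addgt0Pr => e e0.
  have [d d0 dP] := ac_dist acg e0.
  have [t [/andP[t0 t1] rt] tTd] := inf_adherent d0 infS.
  have Tt : T <= t by apply: ge_inf; [case: infS|split=> //; rewrite t0].
  have tT : t - T < d by rewrite ltrBlDl.
  have := dP T t T0 Tt t1 tT.
  have := lerB_dist (g t) (g T); lra.
exists T; split=> // t t0; rewrite le_eqVlt => /orP[/eqP ->|tT]; last first.
  by have := below t t0 tT; lra.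
have [d d0 dP] := ac_dist acg (@ltr01 R).
have [TE|Tpos] := eqVneq T 0; first by rewrite TE g0 normr0; lra.
have Tp : 0 < T by rewrite lt_neqAle eq_sym Tpos.
(* A time before [T], close enough for the curve to move by less than 1. *)
pose s := Num.max 0 (T - d / 2).
have s0 : 0 <= s by rewrite le_max lexx.
have sT : s < T by rewrite gt_max Tp/=; lra.
have sd : T - s < d.
  have : T - d / 2 <= s by rewrite le_max lexx orbT.
  lra.
have := dP s T s0 (ltW sT) T1 sd; have := below s s0 sT.
have := lerB_dist (g T) (g s); lra.
Qed.

(** Until it first reaches norm [r] the curve stays in a bounded region, where its speed is at most
    [M] times that of the control; hence [r] is at most [M] times the length. *)
Lemma sr_dist_gt0 z : z != 0 -> (0 < sr_dist br ip 0%R z)%E.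
Proof.
move=> z0.
have [C C0 CP] := br_bound brH; have [K K0 KP] := vsval_bound ip.
(* The curve must reach norm [r] because [r] is at most the norm of [z]; since [r <= 1], it stays in
   the ball of radius 2 until then. *)
pose r := Num.min 1 `|z|.
have r0 : 0 < r by rewrite lt_min ltr01 normr_gt0.
have r1 : r <= 1 by rewrite ge_min lexx.
have rz : r <= `|z| by rewrite ge_min lexx orbT.
(* On the ball of radius 2 the two bracket terms of [dbch] are at most [C] and [C ^+ 2 / 3] times
   the norm of the control vector; [K] converts that norm. *)
pose M := (1 + C + C ^+ 2) * K.
have M0 : 0 <= M by rewrite mulr_ge0// !addr_ge0// sqr_ge0.
have M1 : 0 < M + 1 by lra.
apply: (@lt_le_trans _ _ (r / (M + 1))%:E); first by rewrite lte_fin divr_gt0.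
apply: sr_dist_ge => u g cu [acg dg] g0 g1.
have [|T [T0 T1 rT gT]] := first_hitting_time acg g0 r0; first by rewrite g1.
have iu := control_integrable cu.
have mI : measurable (I01 : set (measurableTypeR R)) by exact: measurable_itv.
have mT : measurable (`[0, T]%classic : set (measurableTypeR R)) by exact: measurable_itv.
have sT : `[0, T]%classic `<=` I01 by apply: subset_itvl; rewrite bnd_simp.
have iuT : mu.-integrable `[0, T] (EFin \o (fun t => dot_norm ip (u t))).
  exact: integrableS iu.
have : `|g T - g 0| <= \int[mu]_(t in `[0, T]) (M * dot_norm ip (u t)).
  apply: ac_norm_le_integral => //.
  - exact: ac_sub acg.
  - by move=> t; rewrite mulr_ge0// dot_norm_ge0.
  - exact: (integrableZl mT M iuT).
  move: dg; apply: filterS; first exact: (ae_filter_ringOfSetsType mu).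
  move=> t dg t0T; exists (dleft br (g t) (vsval (u t))); first exact/dg/sT.
  move: t0T; rewrite /= in_itv/= => /andP[t0 tT].
  have g2 : `|g t| <= 2 by have := gT t t0 tT; lra.
  rewrite (dleftE brH) /dbch; set v := vsval (u t).
  have b1 : `|br (g t) v| <= 2 * C * `|v|.
    rewrite (le_trans (CP _ _))// ler_wpM2r//.
    by rewrite mulrC ler_wpM2r.
  have b2 : `|br (g t) (br (g t) v)| <= 4 * C ^+ 2 * `|v|.
    rewrite (le_trans (CP _ _))// (@le_trans _ _ (C * 2 * (2 * C * `|v|)))//.
      by rewrite ler_pM// ?mulr_ge0// ler_wpM2l.
    by rewrite le_eqVlt; apply/orP; left; apply/eqP; ring.
  rewrite (le_trans (ler_normD _ _))//.
  have := ler_normD v (2^-1 *: br (g t) v).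
  rewrite !normrZ !ger0_norm ?invr_ge0// => n1.
  have vK := ler_wpM2l (_ : 0 <= 1 + C + C ^+ 2) (KP (u t)).
  have {}vK : (1 + C + C ^+ 2) * `|v| <= M * dot_norm ip (u t).
    by rewrite /M -mulrA; apply: vK; rewrite !addr_ge0// sqr_ge0.
  have c2 : 0 <= C ^+ 2 * `|v| by rewrite mulr_ge0// sqr_ge0.
  move: vK; rewrite !mulrDl mul1r.
  by move: n1 b1 b2 c2; rewrite -!mulrA; lra.
rewrite RintegralZl// g0 subr0 => h.
rewrite lee_fin ler_pdivrMr// (le_trans rT)// (le_trans h)//.
have L0 : 0 <= control_length ip u by exact: control_length_ge0.
have LT : \int[mu]_(t in `[0, T]) dot_norm ip (u t) <= control_length ip u.
  rewrite /control_length [X in X <= _]Rintegral_mkcond [X in _ <= X]Rintegral_mkcond.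
  apply: le_Rintegral => //.
  - by rewrite -restrict_EFin -integrable_mkcond.
  - by rewrite -restrict_EFin -integrable_mkcond.
  - move=> t _; rewrite !patchE; case: ifPn => [tT|_].
      by rewrite ifT// mem_set//; apply: sT; exact: set_mem.
    by case: ifP => // _; exact: dot_norm_ge0.
have := ler_wpM2l M0 LT; lra.
Qed.

End Positivity.

(** * The cusp *)
Section SphereCusp.
Variables (R : realType) (c : R).
Hypothesis c0 : 0 < c.

(** From [tau = 2] on the root is 0, whereas [has_cusp] wants a positive value at every positive
    [tau]; the value 1 chosen there is far from the cusp. *)
Definition sphere_profile (tau : R) : R :=
  if tau < 2 then (Num.sqrt (2 * tau - tau ^+ 2) / c) ^+ 3 else 1.

Lemma sphere_profile0 : sphere_profile 0 = 0.
Proof.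
by rewrite /sphere_profile ltr0n mulr0 expr0n subr0 sqrtr0 mul0r expr0n.
Qed.

Lemma sphere_profile_gt0 tau : 0 < tau -> 0 < sphere_profile tau.
Proof.
move=> t0; rewrite /sphere_profile; case: (ltP tau 2) => // t2.
rewrite exprn_gt0// divr_gt0// sqrtr_gt0.
by rewrite expr2 -mulrBl mulr_gt0// subr_gt0.
Qed.

Lemma sphere_profile_cvg : sphere_profile tau / tau @[tau --> 0^'+] --> (0 : R).
Proof.
apply/cvgrPdist_lt => e e0.
(* With [s ^+ 2 <= 2 * tau] the quotient is at most [2 * s / c ^+ 3], which is below [e] as soon as
   [2 * tau] is below the square of [e * c ^+ 3 / 2]. *)
pose k := (e * c ^+ 3 / 2) ^+ 2 / 2.
have k0 : 0 < k by rewrite divr_gt0// exprn_gt0// divr_gt0// mulr_gt0// exprn_gt0.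
near=> tau.
have t0 : 0 < tau by near: tau; exact: nbhs_right_gt.
have t2 : tau < 2 by near: tau; exact: nbhs_right_lt.
have tk : tau < k by near: tau; exact: nbhs_right_lt.
rewrite sub0r normrN ger0_norm; last first.
  by rewrite divr_ge0 ?(ltW t0)// ltW// sphere_profile_gt0.
rewrite /sphere_profile t2 ltr_pdivrMr//.
set s := Num.sqrt _.
have s0 : 0 <= s by exact: sqrtr_ge0.
have ss : s ^+ 2 <= 2 * tau.
  by rewrite sqr_sqrtr ?lerBlDr ?lerDl ?sqr_ge0// expr2 -mulrBl mulr_ge0 ?subr_ge0// ltW.
rewrite expr_div_n ltr_pdivrMr ?exprn_gt0//.
have sk : s < e * c ^+ 3 / 2.
  have ec : 0 <= e * c ^+ 3 / 2 by rewrite ltW// divr_gt0// mulr_gt0// exprn_gt0.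
  rewrite -(@ltr_pXn2r _ 2%N)// ?nnegrE//; apply: (le_lt_trans ss).
  by move: tk; rewrite /k; lra.
rewrite exprS (@le_lt_trans _ _ (s * (2 * tau)))//; first by rewrite ler_wpM2l.
have : s * (2 * tau) < e * c ^+ 3 / 2 * (2 * tau) by rewrite ltr_pM2r// mulr_gt0.
by move/lt_le_trans; apply; rewrite le_eqVlt; apply/orP; left; apply/eqP; field.
Unshelve. all: by end_near. Qed.

(** The equation reads [(|l| c)^2 = tau (2 - tau)]. As [2 - tau] is positive, it forces [0 <= tau];
    then take square roots and cubes. *)
Lemma sphere_profileP (l tau : R) : `|tau| < 1 ->
  (`|l| * c) ^+ 2 + (1 - tau) ^+ 2 = 1 <->
  0 <= tau /\ `|l ^+ 3| = sphere_profile tau.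
Proof.
rewrite ltr_norml => /andP[tm1 t1].
have -> : sphere_profile tau = (Num.sqrt (2 * tau - tau ^+ 2) / c) ^+ 3.
  by rewrite /sphere_profile ifT//; lra.
have lc : 0 <= `|l| * c by rewrite mulr_ge0// ltW.
rewrite normrX; split.
  move=> E; have E2 : (`|l| * c) ^+ 2 = 2 * tau - tau ^+ 2 by lra.
  split; last by rewrite -E2 sqrtr_sqr (ger0_norm lc) mulfK// gt_eqF.
  have : 0 <= (2 - tau) * tau.
    by rewrite (_ : _ * _ = (`|l| * c) ^+ 2) ?sqr_ge0// E2; ring.
  by rewrite pmulr_rge0// subr_gt0; lra.
move=> [t0 /eqP]; rewrite eqrXn2 ?divr_ge0 ?sqrtr_ge0 ?(ltW c0)// => /eqP ->.
rewrite divfK ?gt_eqF// sqr_sqrtr; first by ring.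
by rewrite expr2 -mulrBl mulr_ge0// subr_ge0; lra.
Qed.

Lemma exists_cube_root (w : R) : exists l, l ^+ 3 = w.
Proof.
have h (x : R) : 0 <= x -> exists l, l ^+ 3 = x.
  move=> x0; exists (x `^ 3^-1).
  by rewrite -powR_mulrn ?powR_ge0// -powRrM mulVf// powRr1.
have [w0|w0] := leP 0 w; first exact: h.
have [|l lE] := h (- w); first by rewrite oppr_ge0 ltW.
by exists (- l); rewrite exprNn lE -signr_odd/= expr1 mulN1r opprK.
Qed.

End SphereCusp.

(** The constant curve; this covers the value [l = 0], which the dilation identity excludes. *)
Lemma sr_dist00 (R : realType) (n : nat) (br : 'rV[R]_n -> 'rV[R]_n -> 'rV[R]_n)
    (V1 : {vspace 'rV[R]_n}) (ip : {dot (subvs_of V1) for idfun}) :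
  is_lie_bracket br -> sr_dist br ip 0 0 = 0%E.
Proof.
move=> brH; apply/eqP; rewrite eq_le sr_dist_ge0 andbT.
pose u (t : R) : subvs_of V1 := 0.
have u0 : dot_norm ip 0 = 0 by rewrite /dot_norm dot0l sqrtr0.
have <- : (control_length ip u)%:E = 0%E.
  rewrite /control_length /u u0 Rintegral_cst ?mul0r//; exact: measurable_itv.
apply: (@sr_dist_le _ _ _ _ _ _ _ u (fun=> 0)) => //.
- split.
    by move=> i; exact: measurable_cst.
  by exists 0; apply: aeW => t _; rewrite /u u0.
- split.
    by apply: (@lipschitz_ac _ _ _ _ _ 0) => *; rewrite subrr normr0 mul0r.
  apply: aeW => t _; rewrite /u linear0 (dleftE brH) /dbch !(br0l brH) !scaler0 !addr0.
  exact: is_derive_cst.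
Qed.

Theorem proposition5p8 (R : realType) (n : nat)
    (br : 'rV[R]_n -> 'rV[R]_n -> 'rV[R]_n) (V : nat -> {vspace 'rV[R]_n})
    (dG : 'rV[R]_n -> 'rV[R]_n -> \bar R)
    (d : 'rV[R]_(n + 1) -> 'rV[R]_(n + 1) -> \bar R) :
  is_lie_bracket br -> is_stratification br 3 V ->
  is_sr_distance br (V 1%N) dG ->
  (forall p s q t, d (pairR p s) (pairR q t) =
     sqrte (dG p q ^+ 2 + (`|t - s| ^+ 2)%:E)%E) ->
  is_sr_distance (bracketR br) (layerR (V 1%N)) d /\
  has_cusp [set x | d (pairR 0 0) x = 1%E] (pairR 0 1).
Proof.
move=> brH stV [ip dGE] dE; split.
  have [ip' ip'E] := dotR_exists ip; exists ip' => x y.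
  by rewrite -(pairRK x) -(pairRK y) dE dGE (sr_dist_product brH ip'E).
have [z [z3 z0 zoo]] := exists_finite_V3 brH stV ip.
have zpos := sr_dist_gt0 brH ip z0.
have [c cE] : exists c, sr_dist br ip 0 z = c%:E.
  by case: (sr_dist br ip 0 z) zpos zoo => // c _ _; exists c.
have c0 : 0 < c by rewrite -lte_fin -cE.
have dist l : dG 0 (l ^+ 3 *: z) = (`|l| * c)%:E.
  rewrite dGE; have [->|l0] := eqVneq l 0.
    by rewrite expr0n scale0r sr_dist00// normr0 mul0r.
  by rewrite (sr_dist_dilation brH stV ip l0 z3) cE.
have sphere l tau : d (pairR 0 0) (pairR (l ^+ 3 *: z) (1 - tau)) = 1%E <->
    (`|l| * c) ^+ 2 + (1 - tau) ^+ 2 = 1.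
  have lc : 0 <= `|l| * c by rewrite mulr_ge0// ltW.
  rewrite dE dist subr0 sqrte_hypot//; split => [[]|->]; last by rewrite sqrtr1.
  move/(congr1 (fun x => x ^+ 2)); rewrite expr1n sqr_sqrtr//.
  by rewrite addr_ge0// sqr_ge0.
(* The second direction points down, so that [tau] is the depth below the pole. *)
have pointE (w : R * R) : pairR 0 1 + w.1 *: pairR z 0 + w.2 *: pairR 0 (- 1) =
    pairR (w.1 *: z) (1 - w.2).
  apply: pairR_inj_ext; rewrite !linearD !linearZ/= ?lsubmx_pairR ?rsubmx_pairR.
    by rewrite scaler0 addr0 add0r.
  by rewrite raddf0 scaler0 addr0 scale_scalar_mx mulrN1 -raddfD.
split.
  have := (sphere 0 0).2; rewrite expr0n scale0r subr0; apply.
  by rewrite normr0 mul0r expr0n add0r expr1n.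
exists (pairR z 0), (pairR 0 (- 1)); split.
  rewrite free_cons span_seq1 seq1_free; apply/andP; split.
    apply/vlineP => -[k /(congr1 lsubmx)].
    rewrite linearZ/= !lsubmx_pairR scaler0 => zE.
    by rewrite zE eqxx in z0.
  apply/eqP => /(congr1 (fun x : 'rV_(n + 1) => rsubmx x 0 0)).
  rewrite rsubmx_pairR linear0 !mxE eqxx mulr1n => /eqP.
  by rewrite oppr_eq0 oner_eq0.
exists (sphere_profile c); split.
- exact: sphere_profile0.
- exact: sphere_profile_gt0.
- exact: sphere_profile_cvg.
exists (ball (pairR 0 1) 1); first exact: nbhsx_ballx.
(* The ball is for the max norm, so its radius bounds the last coordinate and gives the hypothesis
   of [sphere_profileP]. *)
have tauU (v : 'rV[R]_n) tau : ball (pairR 0 1) 1 (pairR v (1 - tau)) -> `|tau| < 1.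
  rewrite -ball_normE/= => /(le_lt_trans (ler_row_norm _ (rshift n 0))).
  by rewrite mxE [X in _ + X]mxE /pairR !row_mxEr !mxE eqxx !mulr1n opprB addrC subrK.
(* Every [w.1] is a cube [l ^+ 3], which reduces the sphere in the plane to the equation in [l] and
   [tau]. *)
have key (w : R * R) : ball (pairR 0 1) 1 (pairR (w.1 *: z) (1 - w.2)) ->
    d (pairR 0 0) (pairR (w.1 *: z) (1 - w.2)) = 1%E <->
    0 <= w.2 /\ `|w.1| = sphere_profile c w.2.
  have [l lE] := exists_cube_root w.1; rewrite -lE => /tauU w2.
  exact: iff_trans (sphere l w.2) (sphere_profileP c0 l w2).
apply/seteqP; split => x.
  move=> [[/= Sx [w _ wx]] Ux]; split => //; exists w => //=.
  by apply/key; rewrite -pointE wx.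
move=> [/= [w /= hw wx] Ux]; split=> //; split; last by exists w.
by rewrite /= -wx pointE; apply/key => //; rewrite -pointE wx.
Qed.
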